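(* For every integer $k\geq 2$ there exist a constant $C>0$ and a family $(Y_n)_{n\in\mathbb N}$ of pure $k$-dimensional simplicial complexes, where $Y_n$ has $n$ vertices and complete $(k-1)$-skeleton, such that: (1) all nontrivial eigenvalues of $\Delta^{\mathrm{up}}_{k-1}(Y_n)$ lie in $[1-C/\sqrt n,\,1+C/\sqrt n]$; (2) there is a cochain $a_n\in C^{k-1}(Y_n;\mathbb Z_2)$ with $\|[a_n]\|\geq \tfrac12-o(1)$ and $\|\delta a_n\|\leq C\log n/n$ (as $n\to\infty$); (3) the reduced integral homology groups satisfy $\tilde H_i(Y_n;\mathbb Z)=0$ for all $i\leq k-1$.
   Context: Complexes have linearly ordered vertex sets; $X_i$ is the set of $i$-faces, $[F:G]$ the oriented incidence number ($[F:G]=(-1)^j$ if $F\setminus G=\{v_j\}$ with $F=\{v_0<\dots<v_i\}$, $0$ if $G\not\subseteq F$). $\deg(F)$ is the number of $k$-faces containing $F$; pure means all maximal faces have dimension $k$. Coboundary: $(\delta f)(H)=\sum_{G}[H:G]f(G)$ (over $\mathbb R$ or $\mathbb Z_2$). $A_{k-1}(X)$: $X_{k-1}\times X_{k-1}$ matrix with entry $[F:F\cap G][G:F\cap G]$ if $|F\cap G|=k-1$ and $F\cup G\in X_k$, else $0$. $\Delta^{\mathrm{up}}_{k-1}(X)=I-D_{k-1}^{-1}A_{k-1}(X)$ with $D_{k-1}$ the diagonal degree matrix; it is self-adjoint for $\langle f,g\rangle=\sum_{F\in X_{k-1}}\deg(F)f(F)g(F)$, and its nontrivial eigenvalues are the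 eigenvalues of its restriction to the orthogonal complement (w.r.t. this inner product) of $B^{k-1}(X;\mathbb R)=\operatorname{im}\delta_{k-2}$. For $\mathbb Z_2$-cochains, $\|f\|=|\{F\in X_i: f(F)=1\}|/|X_i|$ for $f\in C^i(X;\mathbb Z_2)$, and $\|[f]\|=\min\{\|f+\delta g\|: g\in C^{i-1}(X;\mathbb Z_2)\}$.
   Formalization: The properties are claimed for all n at least some N0 depending on k, not for every n: for n ≤ k no pure k-dimensional complex on n vertices with complete (k-1)-skeleton exists; the finitely many remaining n follow by taking the complete k-dimensional complex and enlarging C. *)

(* Defs.v *)
From HB Require Import structures.
From Stdlib Require Import Reals ZArith.
From mathcomp Require Import all_boot.

Set Implicit Arguments.
Unset Strict Implicit.
Unset Printing Implicit Defensive.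

(* A simplicial complex on the (linearly ordered) vertex set 'I_n is a
   downward-closed family of finite sets of vertices (the empty face, of
   dimension -1, is included as soon as the complex is nonempty). *)
Definition is_complex (n : nat) (X : {set {set 'I_n}}) : Prop :=
  forall F G : {set 'I_n}, F \in X -> G \subset F -> G \in X.

(* faces of cardinality s, i.e. the (s-1)-faces: X_{s-1} = faces X s *)
Definition faces (n : nat) (X : {set {set 'I_n}}) (s : nat) : {set {set 'I_n}} :=
  [set F in X | #|F| == s].

Definition pure_dim (n : nat) (X : {set {set 'I_n}}) (k : nat) : Prop :=
  forall F, F \in X -> (forall H, H \in X -> F \subset H -> H = F) -> #|F| = k.+1.

Definition complete_skel (n : nat) (X : {set {set 'I_n}}) (k : nat) : Prop :=
  forall F : {set 'I_n}, #|F| <= k -> F \in X.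

Definition facet (n : nat) (G F : {set 'I_n}) : bool :=
  (G \subset F) && (#|F :\: G| == 1).

(* if F \ G = {v_j} with F = {v_0 < ... < v_i}, this is j *)
Definition incpos (n : nat) (F G : {set 'I_n}) : nat :=
  \sum_(v in F :\: G) #|[set u in F | val u < val v]|.

Definition incR (n : nat) (F G : {set 'I_n}) : R :=
  if facet G F then pow (Ropp R1) (incpos F G) else R0.
Definition incZ (n : nat) (F G : {set 'I_n}) : Z :=
  if facet G F then Z.pow (Z.opp 1%Z) (Z.of_nat (incpos F G)) else 0%Z.

Definition deg (n : nat) (X : {set {set 'I_n}}) (k : nat) (F : {set 'I_n}) : nat :=
  #|[set H in faces X k.+1 | F \subset H]|.

Local Open Scope R_scope.

Definition rsum (n : nat) (A : {set {set 'I_n}}) (f : {set 'I_n} -> R) : R :=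
  \big[Rplus/0]_(F in A) f F.

Definition Aup (n : nat) (X : {set {set 'I_n}}) (k : nat) (F G : {set 'I_n}) : R :=
  if (#|F :&: G| == k.-1)%N && (F :|: G \in X)
  then incR F (F :&: G) * incR G (F :&: G) else 0.

Definition Lap_up (n : nat) (X : {set {set 'I_n}}) (k : nat)
    (f : {set 'I_n} -> R) (F : {set 'I_n}) : R :=
  f F - / INR (deg X k F) * rsum (faces X k) (fun G => Aup X k F G * f G).

Definition cobR (n : nat) (X : {set {set 'I_n}}) (s : nat)
    (g : {set 'I_n} -> R) (H : {set 'I_n}) : R :=
  rsum (faces X s) (fun G => incR H G * g G).

Definition inner (n : nat) (X : {set {set 'I_n}}) (k : nat) (f g : {set 'I_n} -> R) : R :=
  rsum (faces X k) (fun F => INR (deg X k F) * f F * g F).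

(* lam is a nontrivial eigenvalue of Delta^up_{k-1}(X): an eigenvalue of its
   restriction to the orthogonal complement of B^{k-1} = im delta_{k-2} *)
Definition nontrivial_eig (n : nat) (X : {set {set 'I_n}}) (k : nat) (lam : R) : Prop :=
  exists f : {set 'I_n} -> R,
    (exists F, F \in faces X k /\ f F <> 0) /\
    (forall g : {set 'I_n} -> R, inner X k f (cobR X k.-1 g) = 0) /\
    (forall F, F \in faces X k -> Lap_up X k f F = lam * f F).

Definition cob2 (n : nat) (X : {set {set 'I_n}}) (s : nat)
    (g : {set 'I_n} -> bool) (H : {set 'I_n}) : bool :=
  \big[addb/false]_(G in faces X s | facet G H) g G.

Definition norm2 (n : nat) (X : {set {set 'I_n}}) (s : nat) (f : {set 'I_n} -> bool) : R :=
  INR #|[set F in faces X s | f F]| / INR #|faces X s|.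

Definition class_norm2 (n : nat) (X : {set {set 'I_n}}) (s : nat) (f : {set 'I_n} -> bool) : R :=
  INR (\big[minn/#|faces X s|]_(g : {ffun {set 'I_n} -> bool})
         #|[set F in faces X s | f F (+) cob2 X s.-1 g F]|)
  / INR #|faces X s|.

Local Close Scope R_scope.

Definition bdZ (n : nat) (X : {set {set 'I_n}}) (s : nat)
    (c : {set 'I_n} -> Z) (G : {set 'I_n}) : Z :=
  \big[Z.add/0%Z]_(F in faces X s) (incZ F G * c F)%Z.

(* reduced homology H~_i(X;Z) = 0 : every reduced i-cycle is an i-boundary
   (the augmentation is the boundary into the empty (-1)-face) *)
Definition red_hom_vanishes (n : nat) (X : {set {set 'I_n}}) (i : nat) : Prop :=
  forall c : {set 'I_n} -> Z,
    (forall G, G \in faces X i -> bdZ X i.+1 c G = 0%Z) ->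
    exists d : {set 'I_n} -> Z,
      forall F, F \in faces X i.+1 -> c F = bdZ X i.+2 d F.

(* Main.v *)
Require Import Defs.
From Stdlib Require Import Reals ZArith.
From mathcomp Require Import all_boot all_order all_algebra.
From mathcomp Require Import ring lra zify ssrZ.
From mathcomp Require Import boolp reals Rstruct sequences exp.
From mathcomp Require classical_sets.

(* Take a random cochain [a] and let the top faces be the sets [H] of the top
   cardinality with [delta a (H) = 0], together with all those containing a fixed
   vertex [v0].  The cone over [v0] kills the homology, and only the O(1/n)
   fraction of faces through [v0] can carry [delta a].

   For a fixed vertex [w] the signs [s(H) = (-1)^(delta a (H))], [w \in H], are
   independent, so by Hoeffding's inequality and a net argument every link matrix
   [s(x |: (y |: W))] has norm O(sqrt n) with overwhelming probability, all
   degrees are at least [n/4], and [a] is almost balanced against every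
   coboundary; a union bound gives an [a] with all three properties.

   The quadratic form of [A_{k-1}] is a sum over [W] of the forms of the link
   matrices, and each of these is a multiple of the all-ones matrix up to
   O(sqrt n).  Hence the form at [f] is controlled by the boundary of [f], which
   is small when [f] is orthogonal to the coboundaries.

   Below [m = k - 1], so that [W], [F], [H] have [m], [m.+1], [m.+2] vertices. *)

Set Implicit Arguments.
Unset Strict Implicit.
Unset Printing Implicit Defensive.

Import Order.TTheory GRing.Theory Num.Theory.
Local Open Scope ring_scope.

Section Facets.
Variable n : nat.
Implicit Types (F G H W : {set 'I_n}) (x y : 'I_n).

Definition sets_of_card s : {set {set 'I_n}} :=
  [set F : {set 'I_n} | #|F| == s].

Lemma card_sets_of_card s : #|sets_of_card s| = 'C(n, s).
Proof. by rewrite card_draws card_ord. Qed.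

Lemma facetP G F : reflect (exists2 x, x \notin G & F = x |: G) (facet G F).
Proof.
apply: (iffP andP) => [[sGF /cards1P[x FGx]]|[x xG ->]].
  have : x \in F :\: G by rewrite FGx set11.
  rewrite inE => /andP[xG xF]; exists x => //.
  by rewrite -FGx -[LHS](setID F G) (setIidPr sGF) setUC.
split; first exact: subsetUr.
by rewrite setDUl setDv setU0 (setDidPl _) ?cards1 // disjoints1.
Qed.

Lemma facet_setU1 G x : x \notin G -> facet G (x |: G).
Proof. by move=> xG; apply/facetP; exists x. Qed.

Lemma facet_card G F : facet G F -> #|F| = #|G|.+1.
Proof. by case/facetP => x xG ->; rewrite cardsU1 xG. Qed.

Lemma facet_sub G F : facet G F -> G \subset F.
Proof. by case/andP. Qed.

Lemma facet_card_in s G F : facet G F ->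
  (F \in sets_of_card s.+1) = (G \in sets_of_card s).
Proof. by move=> /facet_card cF; rewrite !inE cF eqSS. Qed.

Lemma facets_setU F G H : facet F H -> facet G H -> F != G -> F :|: G = H.
Proof.
move=> fF fG FG; apply/eqP; rewrite eqEcard subUset !facet_sub //=.
rewrite (facet_card fF) ltn_neqAle subset_leq_card ?subsetUl // andbT.
apply: contra FG => cFG.
have /eqP eF : F == F :|: G by rewrite eqEcard subsetUl -(eqP cFG) leqnn.
rewrite eq_sym eqEcard eF subsetUr -eF.
by have := facet_card fF; rewrite (facet_card fG) => -[->] /=.
Qed.

Lemma cofacets_setI F G W : facet W F -> facet W G -> F != G -> F :&: G = W.
Proof.
move=> fF fG FG; apply/eqP; rewrite eq_sym eqEcard subsetI !facet_sub //=.
rewrite -ltnS -(facet_card fF) ltn_neqAle subset_leq_card ?subsetIl // andbT.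
apply: contra FG => cFG.
have /eqP eF : F :&: G == F by rewrite eqEcard subsetIl (eqP cFG) leqnn.
rewrite eqEcard -{1}eF subsetIr (facet_card fG) -(facet_card fF).
exact: leqnn.
Qed.

Lemma setU1_inj G : {in [pred x | x \notin G] &, injective (fun x => x |: G)}.
Proof.
move=> x y xG yG /= e; have : x \in y |: G by rewrite -e setU11.
by rewrite in_setU1 (negPf xG) orbF => /eqP.
Qed.

Lemma big_cofacets (T : Type) (idx : T) (op : Monoid.com_law idx) G
    (f : {set 'I_n} -> T) :
  \big[op/idx]_(F | facet G F) f F = \big[op/idx]_(x | x \notin G) f (x |: G).
Proof.
rewrite (eq_bigl [in [set x |: G | x in [pred x | x \notin G]]]); last first.
  move=> F; apply/facetP/imsetP => -[x xG ->]; by exists x.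
by rewrite big_imset //; exact: setU1_inj.
Qed.

Lemma big_facets (T : Type) (idx : T) (op : Monoid.com_law idx) F
    (f : {set 'I_n} -> T) :
  \big[op/idx]_(G | facet G F) f G = \big[op/idx]_(x in F) f (F :\ x).
Proof.
rewrite (eq_bigl [in [set F :\ x | x in F]]); last first.
  move=> G; apply/facetP/imsetP => [[x xG ->]|[x xF ->]].
    by exists x; rewrite ?setU11 // setU1K.
  by exists x; rewrite ?setD11 // setD1K.
rewrite big_imset // => x y xF yF /= e.
apply/eqP; apply: contraTT xF => nxy.
have : x \notin F :\ y by rewrite -e setD11.
by rewrite !inE nxy.
Qed.

Lemma card_notin F : #|[pred x | x \notin F]| = (n - #|F|)%N.
Proof.
rewrite -[X in (X - _)%N](card_ord n) -(cardsC F) addKn.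
by apply: eq_card => x; rewrite !inE.
Qed.

Lemma facet_subE G F : G \subset F -> facet G F = (#|F| == #|G|.+1).
Proof.
move=> sGF; rewrite /facet sGF /= cardsD (setIidPr sGF).
by rewrite -(eqn_add2r #|G|) subnK ?add1n // subset_leq_card.
Qed.

Lemma facet_setU_setI F G : facet F (F :|: G) = facet (F :&: G) G.
Proof.
rewrite !facet_subE ?subsetUl ?subsetIr //.
by rewrite -(eqn_add2r #|F :&: G|) cardsUI addSn -addnS eqn_add2l.
Qed.

Lemma sum_sets_cofacets (V : nmodType) s W (h : {set 'I_n} -> V) :
  W \in sets_of_card s -> (forall F, ~~ facet W F -> h F = 0) ->
  \sum_(F in sets_of_card s.+1) h F = \sum_(F | facet W F) h F.
Proof.
move=> Ws h0; rewrite big_mkcond [RHS]big_mkcond; apply: eq_bigr => F _.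
by case: (boolP (facet W F)) => [/facet_card_in ->|/h0 ->];
  rewrite ?Ws ?if_same.
Qed.

Lemma sum_sets_facets (V : nmodType) s F (h : {set 'I_n} -> V) :
  F \in sets_of_card s.+1 -> (forall W, ~~ facet W F -> h W = 0) ->
  \sum_(W in sets_of_card s) h W = \sum_(W | facet W F) h W.
Proof.
move=> Fs h0; rewrite big_mkcond [RHS]big_mkcond; apply: eq_bigr => W _.
by case: (boolP (facet W F)) => [/facet_card_in <-|/h0 ->];
  rewrite ?Fs ?if_same.
Qed.

Lemma sum_facets_exchange (V : nmodType) s (q : {set 'I_n} -> {set 'I_n} -> V) :
  \sum_(W in sets_of_card s) \sum_(F | facet W F) q W F =
  \sum_(F in sets_of_card s.+1) \sum_(W | facet W F) q W F.
Proof.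
rewrite (exchange_big_dep [in sets_of_card s.+1]) /= => [|W F Ws WF]; last first.
  by rewrite (facet_card_in _ WF).
apply: eq_bigr => F Fs; apply: eq_bigl => W.
by case: (boolP (facet W F)) => [/facet_card_in <-|]; rewrite ?Fs ?andbF.
Qed.

Definition pos W x : nat := #|[set u in W | (val u < val x)%N]|.

Lemma pos_setU1 W x y : y \notin W -> pos (y |: W) x = ((y < x) + pos W x)%N.
Proof.
move=> yW; rewrite /pos.
have -> : [set u in y |: W | (val u < val x)%N] =
   (if (y < x)%N then [set y] else set0) :|: [set u in W | (val u < val x)%N].
  apply/setP => u; rewrite !inE; case: (boolP (y < x)%N) => yx; rewrite !inE;
  case: (eqVneq u y) => [->|] //=; rewrite ?yx ?(negPf yW) ?(negPf yx) //.
by case: ifP => yx; rewrite ?set0U // cardsU1 inE (negPf yW).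
Qed.

Lemma incpos_setU1 W x : x \notin W -> incpos (x |: W) W = pos W x.
Proof.
move=> xW; rewrite /incpos.
rewrite (_ : _ :\: _ = [set x]) ?big_set1; last first.
  by rewrite setDUl setDv setU0 (setDidPl _) // disjoints1.
by rewrite -/(pos (x |: W) x) pos_setU1 // ltnn.
Qed.

End Facets.

Section Incidence.
Variables (R : comNzRingType) (n : nat).
Implicit Types (F G H W : {set 'I_n}) (x y : 'I_n).

Definition inc F G : R := if facet G F then (-1) ^+ incpos F G else 0.

Lemma inc_setU1 W x : x \notin W -> inc (x |: W) W = (-1) ^+ pos W x.
Proof. by move=> xW; rewrite /inc facet_setU1 // incpos_setU1. Qed.

Lemma inc_eq0 F G : ~~ facet G F -> inc F G = 0.
Proof. by rewrite /inc => /negPf ->. Qed.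

Lemma incxx F : inc F F = 0.
Proof. by rewrite inc_eq0 // /facet setDv cards0 andbF. Qed.

Lemma inc_sqr F G : facet G F -> inc F G ^+ 2 = 1.
Proof. by rewrite /inc => ->; rewrite sqrr_sign. Qed.

Definition bd (f : {set 'I_n} -> R) W : R := \sum_F inc F W * f F.

Lemma bdE_cofacets f W : bd f W =
  \sum_(x | x \notin W) inc (x |: W) W * f (x |: W).
Proof.
rewrite -(big_cofacets _ W (fun F => inc F W * f F)) /= [RHS]big_mkcond /=.
by apply: eq_bigr => F _; case: ifPn => // /inc_eq0 ->; rewrite mul0r.
Qed.

Lemma inc_exchange W x y : x \notin W -> y \notin W -> x != y ->
  inc (x |: (y |: W)) (y |: W) * inc (y |: W) W =
  - (inc (y |: (x |: W)) (x |: W) * inc (x |: W) W).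
Proof.
move=> xW yW xy; have yx : y != x by rewrite eq_sym.
rewrite !inc_setU1 ?inE ?negb_or ?xy ?yx // !pos_setU1 //.
rewrite -!exprD -addnA [(pos W x + pos W y)%N]addnC -addnA !exprD -mulNr.
congr (_ * _); case: ltngtP => [||e]; rewrite ?expr1 ?expr0 ?opprK //.
by rewrite (val_inj e) eqxx in xy.
Qed.

Lemma sum_inc_inc_eq0 H W : \sum_F inc H F * inc F W = 0.
Proof.
transitivity (bd (inc H) W); first by apply: eq_bigr => F _; exact: mulrC.
rewrite bdE_cofacets.
case: (boolP [exists x, (x \notin W) && facet (x |: W) H]); last first.
  move=> /existsPn noH; rewrite big1 // => x xW.
  by have := noH x; rewrite xW /= => /inc_eq0 ->; rewrite mulr0.
case/existsP => x /andP[xW /facetP[y yxW eH]].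
move: yxW; rewrite in_setU1 negb_or => /andP[yx yW].
rewrite (bigD1 x) //= (bigD1 y) /=; last by rewrite yW yx.
rewrite big1 ?addr0 => [|z /andP[/andP[zW zx] zy]]; last first.
  rewrite [inc H _]inc_eq0 ?mulr0 //; apply/negP => /facet_sub/subsetP/(_ z).
  by rewrite eH !inE eqxx (negPf zW) (negPf zx) (negPf zy) => /(_ isT).
rewrite eH mulrC inc_exchange //.
by rewrite setUCA [inc (y |: W) W * _]mulrC addNr.
Qed.

Lemma inc_up_down W x y : x \notin W -> y \notin W -> x != y ->
  inc (x |: (y |: W)) (x |: W) * inc (x |: (y |: W)) (y |: W) =
  - (inc (x |: W) W * inc (y |: W) W).
Proof.
move=> xW yW xy; have swap := inc_exchange xW yW xy.
rewrite [x |: (y |: W)]setUCA in swap *.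
have fy : facet W (y |: W) by exact: facet_setU1.
have fx : facet (x |: W) (y |: (x |: W)).
  by apply: facet_setU1; rewrite in_setU1 negb_or yW eq_sym xy.
transitivity (inc (y |: W) W * inc (y |: (x |: W)) (x |: W) *
   (inc (y |: (x |: W)) (y |: W) * inc (y |: W) W)).
  rewrite -[LHS](mul1r) -(inc_sqr fy); ring.
by rewrite swap -[in RHS](mul1r (inc (x |: W) W)) -(inc_sqr fx); ring.
Qed.

Lemma inc_setU_setI F G : F != G ->
  inc (F :|: G) F * inc (F :|: G) G =
  - (inc F (F :&: G) * inc G (F :&: G)).
Proof.
move=> FG.
have FU_facet : facet F (F :|: G) = facet (F :&: G) G := facet_setU_setI F G.
have GU_facet : facet G (F :|: G) = facet (F :&: G) F.
  by rewrite setUC setIC facet_setU_setI.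
case: (boolP (facet (F :&: G) F)) => [fF|nF]; last first.
  by rewrite [inc _ G]inc_eq0 ?GU_facet // [inc F _]inc_eq0 // mulr0 mul0r oppr0.
case: (boolP (facet (F :&: G) G)) => [fG|nG]; last first.
  by rewrite [inc _ F]inc_eq0 ?FU_facet // [inc G _]inc_eq0 // mulr0 mul0r oppr0.
case/facetP: fF; case/facetP: fG; set W := F :&: G => y yW eG x xW eF.
have eU : F :|: G = x |: (y |: W) by rewrite eF eG setUACA setUid setUA.
have xy : x != y by apply: contraNneq FG => e; rewrite eF eG e.
by have := inc_up_down xW yW xy; rewrite -eU -eF -eG.
Qed.

End Incidence.

Section BilinearForm.
Variables (R : comNzRingType) (n : nat).
Implicit Types (M : 'M[R]_n) (u v : 'rV[R]_n).

Definition bilin M u v : R := (u *m M *m v^T) 0 0.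

Lemma bilinE M u v : bilin M u v = \sum_x \sum_y M x y * (u 0 x * v 0 y).
Proof.
rewrite /bilin mxE exchange_big /=; apply: eq_bigr => y _.
by rewrite !mxE mulr_suml; apply: eq_bigr => x _; ring.
Qed.

Lemma bilin0l M v : bilin M 0 v = 0.
Proof. by rewrite /bilin !mul0mx mxE. Qed.

Lemma bilin0r M u : bilin M u 0 = 0.
Proof. by rewrite /bilin linear0 mulmx0 mxE. Qed.

Lemma bilinDl M u u' v : bilin M (u + u') v = bilin M u v + bilin M u' v.
Proof. by rewrite /bilin !mulmxDl mxE. Qed.

Lemma bilinDr M u v v' : bilin M u (v + v') = bilin M u v + bilin M u v'.
Proof. by rewrite /bilin linearD mulmxDr mxE. Qed.

Lemma bilinZl M a u v : bilin M (a *: u) v = a * bilin M u v.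
Proof. by rewrite /bilin -!scalemxAl mxE. Qed.

Lemma bilinZr M a u v : bilin M u (a *: v) = a * bilin M u v.
Proof. by rewrite /bilin linearZ -scalemxAr mxE. Qed.

Lemma bilinDm M M' u v : bilin (M + M') u v = bilin M u v + bilin M' u v.
Proof. by rewrite /bilin mulmxDr mulmxDl mxE. Qed.

Lemma bilinBm M M' u v : bilin (M - M') u v = bilin M u v - bilin M' u v.
Proof. by rewrite /bilin mulmxBr mulmxBl !mxE. Qed.

Lemma bilinZm M a u v : bilin (a *: M) u v = a * bilin M u v.
Proof. by rewrite /bilin -scalemxAr -scalemxAl mxE. Qed.

Lemma bilin_tr M u v : bilin M^T u v = bilin M v u.
Proof.
rewrite /bilin (_ : u *m _ *m _ = (v *m M *m u^T)^T) ?mxE //.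
by rewrite !trmx_mul trmxK mulmxA.
Qed.

End BilinearForm.

Section UpForm.
Variables (R : comNzRingType) (n : nat).
Implicit Types (F G H W : {set 'I_n}) (x y : 'I_n) (f g t : {set 'I_n} -> R).

Local Notation inc := (@inc R n).
Local Notation K := (@sets_of_card n).

Definition cob g F : R := \sum_W inc F W * g W.

Lemma cobE_card s g F : F \in K s.+1 -> cob g F = \sum_(W in K s) inc F W * g W.
Proof.
move=> Fs; rewrite (sum_sets_facets Fs) => [|W /inc_eq0 ->]; last exact: mul0r.
rewrite /cob [RHS]big_mkcond; apply: eq_bigr => W _.
by case: ifPn => // /inc_eq0 ->; rewrite mul0r.
Qed.

Lemma bdE_card s f W : W \in K s -> bd f W = \sum_(F in K s.+1) inc F W * f F.
Proof.
move=> Ws; rewrite (sum_sets_cofacets Ws) => [|F /inc_eq0 ->];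
  last exact: mul0r.
by rewrite bdE_cofacets (big_cofacets _ W (fun F => inc F W * f F)).
Qed.

Lemma cob_cob g H : cob (cob g) H = 0.
Proof.
rewrite /cob; under eq_bigr => F _ do rewrite mulr_sumr.
rewrite exchange_big big1 //= => W _.
by under eq_bigr => F _ do rewrite mulrA;
  rewrite -mulr_suml sum_inc_inc_eq0 mul0r.
Qed.

Lemma cob_bd_adjoint s f g :
  \sum_(F in K s.+1) f F * cob g F = \sum_(W in K s) bd f W * g W.
Proof.
under eq_bigr => F Fs do rewrite (cobE_card _ Fs) mulr_sumr.
under [RHS]eq_bigr => W Ws do rewrite (bdE_card _ Ws) mulr_suml.
rewrite exchange_big /=; apply: eq_bigr => W _; apply: eq_bigr => F _.
by ring.
Qed.

Definition cone_op (v0 : 'I_n) f F : R := inc F (F :\ v0) * f (F :\ v0).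

Lemma cone_op_notin v0 f F : v0 \notin F -> cone_op v0 f F = 0.
Proof.
move=> v0F; rewrite /cone_op (_ : F :\ v0 = F) ?incxx ?mul0r //.
by apply/setDidPl; rewrite disjoint_sym disjoints1.
Qed.

Lemma bd_cone_op v0 f F : bd (cone_op v0 f) F = f F - cone_op v0 (bd f) F.
Proof.
case: (boolP (v0 \in F)) => v0F; last first.
  rewrite [cone_op _ (bd f) F]cone_op_notin // subr0.
  rewrite bdE_cofacets (bigD1 v0) //= big1 ?addr0 => [|x /andP[xF xv0]].
    by rewrite /cone_op setU1K // mulrA -expr2 inc_sqr ?mul1r // facet_setU1.
  by rewrite cone_op_notin ?mulr0 // in_setU1 negb_or eq_sym xv0.
rewrite {2}/cone_op; set G := F :\ v0; have v0G : v0 \notin G by rewrite setD11.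
have -> : F = v0 |: G by rewrite setD1K.
have facet_G : facet G (v0 |: G) by exact: facet_setU1.
rewrite [bd f G]bdE_cofacets (bigD1 v0) //= mulrDr mulrA -expr2 inc_sqr //
  mul1r.
rewrite opprD addrA subrr add0r bdE_cofacets mulr_sumr -sumrN.
apply: eq_big => [x|x /[!in_setU1] /norP[xv0 xG]];
  first by rewrite in_setU1 negb_or andbC.
have -> : cone_op v0 f (x |: (v0 |: G)) =
    inc (x |: (v0 |: G)) (x |: G) * f (x |: G).
  by rewrite /cone_op setUCA setU1K // in_setU1 negb_or eq_sym xv0.
by rewrite mulrCA mulrA inc_up_down //; ring.
Qed.

Definition up_deg t F : R := \sum_(x | x \notin F) t (x |: F).

(* As [inc] vanishes off facets, this is zero unless [F] and [G] are distinct
   cofacets of [F :&: G]. *)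
Definition up_coef t F G : R :=
  inc F (F :&: G) * inc G (F :&: G) * t (F :|: G).

Definition up_form s t f g : R :=
  \sum_(F in K s) \sum_(G in K s) up_coef t F G * (f F * g G).

Lemma sum_inc_cofacet_pair s t F G : F \in K s -> G \in K s ->
  \sum_(H in K s.+1) t H * (inc H F * inc H G) =
  (if F == G then up_deg t F else 0) - up_coef t F G.
Proof.
move=> Fs Gs; rewrite (sum_sets_cofacets Fs) => [|H /inc_eq0 ->]; last first.
  by rewrite mul0r mulr0.
rewrite /up_coef; case: eqVneq => [<-|FG].
  rewrite setIid incxx !mul0r subr0.
  rewrite /up_deg -(big_cofacets _ F t) /=.
  by apply: eq_bigr => H /inc_sqr FH; rewrite -expr2 FH mulr1.
transitivity (t (F :|: G) * (inc (F :|: G) F * inc (F :|: G) G)); last first.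
  by rewrite inc_setU_setI //; ring.
case: (boolP (facet F (F :|: G))) => FU; last first.
  rewrite [inc _ F]inc_eq0 // mul0r mulr0 big1 // => H FH.
  rewrite [inc H G]inc_eq0 ?mulr0 //.
  by apply: contra FU => /(facets_setU FH) ->.
rewrite (bigD1 (F :|: G)) //= big1 ?addr0 // => H /andP[FH UH].
rewrite [inc H G]inc_eq0 ?mulr0 //.
by apply: contra UH => /(facets_setU FH) ->.
Qed.

Lemma up_form_cob s t f g : up_form s t f g =
  \sum_(F in K s) up_deg t F * (f F * g F) -
  \sum_(H in K s.+1) t H * (cob f H * cob g H).
Proof.
have -> : \sum_(H in K s.+1) t H * (cob f H * cob g H) =
   \sum_(F in K s) \sum_(G in K s)
     (f F * g G) * \sum_(H in K s.+1) t H * (inc H F * inc H G).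
  under eq_bigr => H Hs do rewrite !(cobE_card _ Hs) big_distrl /= mulr_sumr.
  rewrite exchange_big /=; apply: eq_bigr => F _.
  under eq_bigr => H _ do rewrite !mulr_sumr.
  rewrite exchange_big /=; apply: eq_bigr => G _; rewrite mulr_sumr.
  by apply: eq_bigr => H _; ring.
rewrite -sumrB; apply: eq_bigr => F Fs.
transitivity (up_deg t F * (f F * g F) - \sum_(G in K s)
   ((if F == G then up_deg t F * (f F * g F) else 0) -
      up_coef t F G * (f F * g G))).
  rewrite sumrB -big_mkcondr /=.
  rewrite [X in _ - (X - _)](big_pred1 F) ?subKr // => G /=.
  by rewrite eq_sym; case: eqP => [->|]; rewrite ?andbF ?Fs.
congr (_ - _); apply: eq_bigr => G Gs; rewrite (sum_inc_cofacet_pair _ Fs Gs).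
by case: eqP => [<-|_]; ring.
Qed.

Definition link_mx t W : 'M[R]_n :=
  \matrix_(x, y)
    if [&& x \notin W, y \notin W & x != y] then t (x |: (y |: W)) else 0.

(* The vector is supported outside [W], since [inc W W = 0]. *)
Definition link_vec f W : 'rV[R]_n := \row_x (inc (x |: W) W * f (x |: W)).

Lemma link_vec_in f W x : x \in W -> link_vec f W 0 x = 0.
Proof.
by move=> xW; rewrite mxE (setUidPr _) ?sub1set // incxx mul0r.
Qed.

Lemma bd_link f W : bd f W = \sum_(x | x \notin W) link_vec f W 0 x.
Proof. by rewrite bdE_cofacets; apply: eq_bigr => x _; rewrite mxE. Qed.

Lemma sum_link_vec_sqr s f :
  \sum_(W in K s) \sum_x link_vec f W 0 x ^+ 2 =
    s.+1%:R * \sum_(F in K s.+1) f F ^+ 2.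
Proof.
transitivity (\sum_(W in K s) \sum_(F | facet W F) f F ^+ 2).
  apply: eq_bigr => W _; rewrite (bigID [in W]) /= big1 ?add0r => [|x xW]; last first.
    by rewrite link_vec_in // expr0n.
  rewrite (big_cofacets _ W (fun F => f F ^+ 2)); apply: eq_bigr => x xW.
  by rewrite mxE exprMn inc_sqr ?mul1r // facet_setU1.
rewrite sum_facets_exchange mulr_sumr; apply: eq_bigr => F;
  rewrite inE => /eqP cF.
by rewrite (big_facets _ _ (fun=> f F ^+ 2)) /= sumr_const cF mulr_natl.
Qed.

Lemma bilin_link_mx t W f g :
  bilin (link_mx t W) (link_vec f W) (link_vec g W) =
  \sum_(F | facet W F) \sum_(G | facet W G)
    (if F != G then inc F W * inc G W * t (F :|: G) else 0) * (f F * g G).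
Proof.
rewrite bilinE (bigID [in W]) /= big1 ?add0r => [|x xW]; last first.
  by apply: big1 => y _; rewrite link_vec_in // mul0r mulr0.
rewrite (big_cofacets _ W); apply: eq_bigr => x xW.
rewrite (bigID [in W]) /= big1 ?add0r => [|y yW]; last first.
  by rewrite [link_vec g W 0 y]link_vec_in // !mulr0.
rewrite (big_cofacets _ W); apply: eq_bigr => y yW.
rewrite !mxE xW yW (inj_in_eq (@setU1_inj _ W)) //=.
case: eqP => _ /=; first by rewrite !mul0r.
by rewrite setUACA setUid -setUA; ring.
Qed.

Lemma up_coef_sum_facets s t F G : F \in K s.+1 ->
  up_coef t F G =
  \sum_(W in K s) if F != G then inc F W * inc G W * t (F :|: G) else 0.
Proof.
move=> Fs; rewrite (sum_sets_facets Fs) => [|W /inc_eq0 ->]; last first.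
  by rewrite !mul0r if_same.
case: eqVneq => [<-|FG] /=.
  by rewrite big1 // /up_coef setIid incxx !mul0r.
case: (boolP (facet (F :&: G) F)) => IF; last first.
  rewrite /up_coef inc_eq0 // !mul0r big1 // => W WF.
  rewrite [inc G W]inc_eq0 ?mulr0 ?mul0r //.
  by apply: contra IF => WG; rewrite (cofacets_setI WF WG FG).
rewrite (bigD1 (F :&: G)) //= big1 ?addr0 // => W /andP[WF nW].
rewrite [inc G W]inc_eq0 ?mulr0 ?mul0r //.
by apply: contra nW => WG; rewrite (cofacets_setI WF WG FG).
Qed.

Lemma up_form_link s t f g : up_form s.+1 t f g =
  \sum_(W in K s) bilin (link_mx t W) (link_vec f W) (link_vec g W).
Proof.
under [RHS]eq_bigr => W _ do rewrite bilin_link_mx.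
rewrite sum_facets_exchange; apply: eq_bigr => F Fs.
transitivity (\sum_(G in K s.+1) \sum_(W in K s)
    (if F != G then inc F W * inc G W * t (F :|: G) else 0) * (f F * g G)).
  by apply: eq_bigr => G Gs; rewrite (up_coef_sum_facets _ _ Fs) mulr_suml.
rewrite exchange_big /= (sum_sets_facets Fs) => [|W WF]; last first.
  by apply: big1 => G _; rewrite [inc F W]inc_eq0 // !mul0r if_same mul0r.
apply: eq_bigr => W WF; apply: sum_sets_cofacets => [|G /inc_eq0 ->].
  by rewrite -(facet_card_in _ WF).
by rewrite mulr0 mul0r if_same mul0r.
Qed.

End UpForm.

Section EuclideanNorm.
Variable R : rcfType.

Lemma sum_sqr_ge0 (I : finType) (P : pred I) (f : I -> R) :
  0 <= \sum_(i | P i) f i ^+ 2.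
Proof. by apply: sumr_ge0 => i _; exact: sqr_ge0. Qed.

Lemma sum_sqr_eq0 (I : finType) (P : pred I) (f : I -> R) :
  \sum_(i | P i) f i ^+ 2 = 0 -> forall i, P i -> f i = 0.
Proof.
move=> /psumr_eq0P sqr0 i Pi; apply/eqP; rewrite -sqrf_eq0 sqr0 // => j _.
exact: sqr_ge0.
Qed.

Lemma cauchy_schwarz (I : finType) (P : pred I) (f g : I -> R) :
  `|\sum_(i | P i) f i * g i| <=
  Num.sqrt (\sum_(i | P i) f i ^+ 2) * Num.sqrt (\sum_(i | P i) g i ^+ 2).
Proof.
set A := \sum_(i | P i) f i ^+ 2; set B := \sum_(i | P i) g i ^+ 2.
set C := \sum_(i | P i) f i * g i.
have A_ge0 : 0 <= A by exact: sum_sqr_ge0.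
have B_ge0 : 0 <= B by exact: sum_sqr_ge0.
rewrite -sqrtrM // -sqrtr_sqr; apply: ler_wsqrtr.
have [B0|nB0] := eqVneq B 0.
  by rewrite B0 mulr0 /C big1 ?expr0n // => i Pi;
    rewrite (sum_sqr_eq0 B0) ?mulr0.
have disc := sum_sqr_ge0 P (fun i => B * f i - C * g i).
rewrite -subr_ge0 -(pmulr_rge0 _ (x := B)); last by rewrite lt_def nB0.
suff <- : \sum_(i | P i) (B * f i - C * g i) ^+ 2 = B * (A * B - C ^+ 2) by [].
under eq_bigr => i _.
  rewrite (_ : _ ^+ 2 =
    B ^+ 2 * f i ^+ 2 - 2 * B * C * (f i * g i) + C ^+ 2 * g i ^+ 2).
    over.
  by ring.
by rewrite big_split sumrB -!mulr_sumr /= -/A -/B -/C; ring.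
Qed.

Definition enorm n (u : 'rV[R]_n) : R := Num.sqrt (\sum_x u 0 x ^+ 2).

Lemma enorm_ge0 n (u : 'rV[R]_n) : 0 <= enorm u.
Proof. exact: sqrtr_ge0. Qed.

Lemma sqr_enorm n (u : 'rV[R]_n) : enorm u ^+ 2 = \sum_x u 0 x ^+ 2.
Proof. by rewrite sqr_sqrtr // sum_sqr_ge0. Qed.

Lemma enorm0 n : enorm (0 : 'rV[R]_n) = 0.
Proof. by rewrite /enorm big1 ?sqrtr0 // => x _; rewrite mxE expr0n. Qed.

Lemma enormZ n a (u : 'rV[R]_n) : enorm (a *: u) = `|a| * enorm u.
Proof.
rewrite /enorm -sqrtr_sqr -sqrtrM ?sqr_ge0 // mulr_sumr.
by congr Num.sqrt; apply: eq_bigr => x _; rewrite mxE exprMn.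
Qed.

Lemma enorm_eq0 n (u : 'rV[R]_n) : enorm u = 0 -> u = 0.
Proof.
move=> u0; apply/rowP => x; rewrite mxE.
by apply: (sum_sqr_eq0 (P := xpredT)); rewrite // -sqr_enorm u0 expr0n.
Qed.

Lemma sqr_entry_le n (u : 'rV[R]_n) x : u 0 x ^+ 2 <= enorm u ^+ 2.
Proof.
by rewrite sqr_enorm (bigD1 x) //= lerDl sum_sqr_ge0.
Qed.

Lemma entry_le_enorm n (u : 'rV[R]_n) x : `|u 0 x| <= enorm u.
Proof.
by rewrite -(@ler_pXn2r _ 2) ?nnegrE ?enorm_ge0 // real_normK ?num_real //
  sqr_entry_le.
Qed.

Lemma enorm_sub_sum n (P : pred 'I_n) (u : 'rV[R]_n) :
  Num.sqrt (\sum_(x | P x) u 0 x ^+ 2) <= enorm u.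
Proof.
by apply: ler_wsqrtr; rewrite [leRHS](bigID P) /= lerDl sum_sqr_ge0.
Qed.

Definition opnorm_le n (M : 'M[R]_n) (E : R) : Prop :=
  forall u v : 'rV[R]_n, `|bilin M u v| <= E * (enorm u * enorm v).

Lemma opnorm_le_trans n (M : 'M[R]_n) E E' : E <= E' -> opnorm_le M E ->
  opnorm_le M E'.
Proof.
move=> EE' ME u v; apply: le_trans (ME u v) _.
by rewrite ler_wpM2r // mulr_ge0 ?enorm_ge0.
Qed.

Lemma opnorm_leD n (M M' : 'M[R]_n) E E' :
  opnorm_le M E -> opnorm_le M' E' -> opnorm_le (M + M') (E + E').
Proof.
move=> ME M'E' u v; rewrite bilinDm mulrDl.
by apply: le_trans (ler_normD _ _) _; rewrite lerD ?ME ?M'E'.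
Qed.

Lemma opnorm_leZ n (M : 'M[R]_n) a E : opnorm_le M E ->
  opnorm_le (a *: M) (`|a| * E).
Proof. by move=> ME u v; rewrite bilinZm normrM -mulrA ler_wpM2l. Qed.

Lemma opnorm_le_tr n (M : 'M[R]_n) E : opnorm_le M E -> opnorm_le M^T E.
Proof. by move=> ME u v; rewrite bilin_tr [enorm u * _]mulrC. Qed.

Lemma opnorm_le_row n (M : 'M[R]_n) x0 :
  (forall x y, x != x0 -> M x y = 0) -> (forall y, `|M x0 y| <= 1) ->
  opnorm_le M (Num.sqrt n%:R).
Proof.
move=> M0 M1 u v; rewrite bilinE (bigD1 x0) //= [X in _ + X]big1 ?addr0; last first.
  by move=> x xx0; rewrite big1 // => y _; rewrite M0 // mul0r.
under eq_bigr => y _ do rewrite mulrCA.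
rewrite -mulr_sumr normrM mulrCA ler_pM ?entry_le_enorm //.
apply: le_trans (cauchy_schwarz _ _ _) _; rewrite ler_wpM2r ?enorm_ge0 //.
apply: ler_wsqrtr; rewrite -[n in leRHS]card_ord -sumr_const.
by apply: ler_sum => y _; rewrite -real_normK ?num_real // exprn_ile1.
Qed.

End EuclideanNorm.

Section UpFormBound.
Variables (R : rcfType) (n : nat).
Implicit Types (F G H W : {set 'I_n}) (f g t : {set 'I_n} -> R).
Local Notation K := (@sets_of_card n).

Definition cochain_norm s f : R := Num.sqrt (\sum_(F in K s) f F ^+ 2).

Lemma sqr_cochain_norm s f : cochain_norm s f ^+ 2 = \sum_(F in K s) f F ^+ 2.
Proof. by rewrite sqr_sqrtr // sum_sqr_ge0. Qed.

Definition off_mx W : 'M[R]_n :=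
  \matrix_(x, y) ((x \notin W) && (y \notin W))%:R.

Lemma bilin_off_mx W (u v : 'rV[R]_n) : bilin (off_mx W) u v =
  (\sum_(x | x \notin W) u 0 x) * (\sum_(x | x \notin W) v 0 x).
Proof.
rewrite bilinE mulr_suml [RHS]big_mkcond; apply: eq_bigr => x _.
case: ifPn => xW; last by apply: big1 => y _; rewrite mxE (negPf xW) mul0r.
rewrite mulr_sumr [RHS]big_mkcond; apply: eq_bigr => y _.
by rewrite mxE xW; case: ifP; rewrite ?mul1r ?mul0r.
Qed.

Lemma sum_enorm_link_vec s f g :
  \sum_(W in K s) enorm (link_vec f W) * enorm (link_vec g W) <=
  s.+1%:R * (cochain_norm s.+1 f * cochain_norm s.+1 g).
Proof.
apply: le_trans (ler_norm _) _; apply: le_trans (cauchy_schwarz _ _ _) _.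
rewrite (eq_bigr _ (fun W _ => sqr_enorm (link_vec f W))).
rewrite (eq_bigr _ (fun W _ => sqr_enorm (link_vec g W))).
rewrite !sum_link_vec_sqr !sqrtrM ?ler0n // mulrACA -expr2 sqr_sqrtr ?ler0n //.
Qed.

Lemma up_form_approx s t (omega : {set 'I_n} -> R) (E : R) f g : 0 <= E ->
  (forall W, W \in K s -> opnorm_le (link_mx t W - omega W *: off_mx W) E) ->
  `|up_form s.+1 t f g - \sum_(W in K s) omega W * (bd f W * bd g W)| <=
  E * s.+1%:R * (cochain_norm s.+1 f * cochain_norm s.+1 g).
Proof.
move=> E0 near; rewrite up_form_link -sumrB.
apply: le_trans (ler_norm_sum _ _ _) _; rewrite -mulrA.
apply: le_trans (ler_wpM2l E0 (sum_enorm_link_vec s f g)).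
rewrite mulr_sumr; apply: ler_sum => W Ws.
by have := near W Ws _ _; rewrite !bd_link -bilin_off_mx -bilinZm -bilinBm;
  apply.
Qed.

Definition weighted_cycle s t f : Prop :=
  forall W, W \in K s -> bd (fun F => up_deg t F * f F) W = 0.

Lemma up_form_cob_eq0 s t f g :
  weighted_cycle s t f -> up_form s.+1 t f (cob g) = 0.
Proof.
move=> cycle_f; rewrite up_form_cob [X in _ - X]big1 ?subr0 => [|H _]; last first.
  by rewrite cob_cob !mulr0.
under eq_bigr => F _ do rewrite mulrA.
by rewrite cob_bd_adjoint big1 // => W Ws; rewrite cycle_f // mul0r.
Qed.

(* Up to [E], the form at [(f, h)] is [w] times the pairing of [h] with
   [g := delta (bd f)].  It vanishes at [(f, g)], which makes [w *: g] small. *)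
Lemma up_form_le s t (omega : {set 'I_n} -> R) (w E : R) f : 0 <= E -> 0 <= w ->
  (forall W, W \in K s -> opnorm_le (link_mx t W - omega W *: off_mx W) E) ->
  (forall W, W \in K s -> omega W * bd f W = w * bd f W) ->
  weighted_cycle s t f ->
  `|up_form s.+1 t f f| <= 2 * E * s.+1%:R * cochain_norm s.+1 f ^+ 2.
Proof.
move=> E0 w0 near omega_w cycle_f; pose g := cob (bd f).
set c := E * s.+1%:R; set N := cochain_norm s.+1 f.
set P := cochain_norm s.+1 g.
have main h : \sum_(W in K s) omega W * (bd f W * bd h W) =
    w * \sum_(F in K s.+1) h F * g F.
  rewrite cob_bd_adjoint mulr_sumr; apply: eq_bigr => W Ws.
  by rewrite mulrA omega_w //; ring.
have N0 : 0 <= N by exact: sqrtr_ge0.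
have P0 : 0 <= P by exact: sqrtr_ge0.
have c0 : 0 <= c by rewrite mulr_ge0.
have wP : w * P <= c * N.
  have [->|nP0] := eqVneq P 0; first by rewrite mulr0 mulr_ge0.
  rewrite -(ler_pM2r (x := P)) ?lt_def ?nP0 // -mulrA -expr2 -[leRHS]mulrA.
  have := up_form_approx f g E0 near.
  rewrite up_form_cob_eq0 // main sub0r normrN -/c -/N -/P.
  rewrite (eq_bigr _ (fun F _ => esym (expr2 (g F)))) -sqr_cochain_norm.
  by apply: le_trans; exact: ler_norm.
have wQ : `|w * \sum_(F in K s.+1) f F * g F| <= c * N ^+ 2.
  rewrite normrM (ger0_norm w0).
  apply: le_trans (ler_wpM2l w0 (cauchy_schwarz _ _ _)) _.
  by rewrite -/N -/P mulrCA mulrC expr2 mulrA ler_wpM2r.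
have := up_form_approx f f E0 near; rewrite main -/c -/N -expr2 => dist.
rewrite -[2 * E * _]mulrA -/c; move: dist wQ.
by rewrite !ler_norml => /andP[? ?] /andP[? ?]; apply/andP; split; lra.
Qed.

End UpFormBound.

Section LinkMatrices.
Variables (R : rcfType) (n : nat).
Implicit Types (H W : {set 'I_n}) (s t : {set 'I_n} -> R).

Definition upper_link_mx t W : 'M[R]_n :=
  \matrix_(x, y)
    if [&& x \notin W, y \notin W & (x < y)%N] then t (x |: (y |: W)) else 0.

Lemma link_mxE_upper t W : link_mx t W =
  upper_link_mx t W + (upper_link_mx t W)^T.
Proof.
apply/matrixP => x y; rewrite !mxE; case: (x \in W) => /=;
  first by rewrite andbF addr0.
case: (y \in W) => /=; first by rewrite addr0.
case: ltngtP => [xy|yx|/val_inj ->]; rewrite ?addr0 ?add0r ?eqxx //.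
  by rewrite ifT //; apply: contraTneq xy => ->; rewrite ltnn.
by rewrite [in RHS]setUCA ifT //; apply: contraTneq yx => ->; rewrite ltnn.
Qed.

Lemma link_mx1_le W : opnorm_le (link_mx (fun=> 1) W - off_mx R W) 1.
Proof.
move=> u v; rewrite bilinBm mul1r.
suff -> : bilin (link_mx (fun=> 1) W) u v - bilin (off_mx R W) u v =
    - \sum_(x | x \notin W) u 0 x * v 0 x.
  rewrite normrN; apply: le_trans (cauchy_schwarz _ _ _) _.
  by rewrite ler_pM ?sqrtr_ge0 ?enorm_sub_sum.
rewrite -bilinBm bilinE -sumrN [RHS]big_mkcond; apply: eq_bigr => x _.
rewrite (bigD1 x) //= big1 => [|y yx]; rewrite !mxE.
  by rewrite eqxx !andbF andbb sub0r addr0; case: (x \in W);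
    rewrite ?mulN1r ?oppr0 ?mul0r.
by rewrite eq_sym yx andbT; case: (_ && _); rewrite subrr mul0r.
Qed.

Lemma link_mx_star_le (v0 : 'I_n) t W : v0 \notin W ->
  (forall H, `|t H| <= 1) -> (forall H, v0 \notin H -> t H = 0) ->
  opnorm_le (link_mx t W) (2 * Num.sqrt n%:R).
Proof.
move=> v0W t1 t0.
pose A : 'M[R]_n := \matrix_(x, y) if x == v0 then link_mx t W x y else 0.
have -> : link_mx t W = A + A^T.
  apply/matrixP => x y; rewrite !mxE.
  have [->|xv0] := eqVneq x v0; have [->|yv0] := eqVneq y v0;
    rewrite ?eqxx ?v0W ?addr0 //=.
  - by rewrite add0r setUCA xv0 eq_sym xv0 !andbT.
  - by rewrite t0 ?if_same // !inE !negb_or v0W ![v0 == _]eq_sym xv0 yv0.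
have A_le : opnorm_le A (Num.sqrt n%:R).
  apply: (@opnorm_le_row _ _ _ v0) => [x y /negPf xv0|y];
    rewrite mxE ?xv0 // eqxx mxE.
  by case: ifP => _; rewrite ?normr0.
by rewrite mulr2n mulrDl mul1r; apply: opnorm_leD (opnorm_le_tr A_le).
Qed.

Lemma eq_link_mx m t t' W : W \in sets_of_card n m ->
  {in sets_of_card n m.+2, t =1 t'} -> link_mx t W = link_mx t' W.
Proof.
rewrite inE => /eqP cW tt'; apply/matrixP => x y; rewrite !mxE.
case: ifP => // /and3P[xW yW xy]; apply: tt'.
by rewrite inE !cardsU1 in_setU1 negb_or xy xW yW cW.
Qed.

Definition cone_weight (v0 : 'I_n) W : R := if v0 \in W then 1 else 2^-1.

(* If [s] is [1] on a family of sets and [-1] off it, this is the indicator of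
   that family enlarged by all the sets containing [v0]. *)
Definition cone_fun (v0 : 'I_n) s H : R :=
  if v0 \in H then 1 else 2^-1 * (1 + s H).

Lemma link_mx_cone_le (v0 : 'I_n) s W (c : R) : 0 <= c ->
  (forall H, `|s H| <= 1) ->
  opnorm_le (upper_link_mx s W) (c * Num.sqrt n%:R) ->
  opnorm_le (link_mx (cone_fun v0 s) W - cone_weight v0 W *: off_mx R W)
    ((c + 3) * Num.sqrt n%:R).
Proof.
move=> c0 s1 upper; set t := cone_fun v0 s.
have n1 : 1 <= Num.sqrt n%:R :> R.
  by rewrite -[leLHS]sqrtr1 ler_wsqrtr // ler1n (leq_ltn_trans _ (ltn_ord v0)).
have cn0 : 0 <= c * Num.sqrt n%:R by rewrite mulr_ge0 ?sqrtr_ge0.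
rewrite /cone_weight; case: ifPn => v0W.
  rewrite scale1r (_ : link_mx t W = link_mx (fun=> 1) W).
    by apply: opnorm_le_trans (link_mx1_le W); rewrite mulrDl; lra.
  by apply/matrixP => x y; rewrite !mxE /t /cone_fun !inE v0W !orbT.
pose e H := if v0 \in H then 2^-1 * (1 - s H) else 0.
have -> : link_mx t W - 2^-1 *: off_mx R W =
    2^-1 *: (link_mx (fun=> 1) W - off_mx R W) +
    2^-1 *: link_mx s W + link_mx e W.
  apply/matrixP => x y; rewrite !mxE /t /cone_fun /e.
  by case: ifP => _; [case: ifP => _ | ]; field.
have star : opnorm_le (link_mx e W) (2 * Num.sqrt n%:R).
  apply: (@link_mx_star_le v0) => // H; rewrite /e; last by move=> /negPf ->.
  case: ifP => _; last by rewrite normr0.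
  by have := s1 H; rewrite !ler_norml => /andP[? ?]; lra.
have sign := opnorm_leD upper (opnorm_le_tr upper);
  rewrite -link_mxE_upper in sign.
have ones_sign :=
  opnorm_leD (opnorm_leZ 2^-1 (link_mx1_le W)) (opnorm_leZ 2^-1 sign).
have := opnorm_leD ones_sign star.
by apply: opnorm_le_trans; rewrite ger0_norm ?invr_ge0 //; lra.
Qed.

End LinkMatrices.

Section IntegerNet.
Variables (R : realType) (n N : nat).

Definition net_type := {ffun 'I_n -> 'I_N.+1 * bool}.

Definition int_net : {set net_type} :=
  [set z : net_type | (\sum_i (z i).1 ^ 2 <= N)%N].

Definition net_vec (z : net_type) : 'rV[R]_n :=
  \row_i ((-1) ^+ (z i).2 * (z i).1%:R).

Lemma sqr_enorm_net_vec z : z \in int_net -> enorm (net_vec z) ^+ 2 <= N%:R.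
Proof.
rewrite inE -(ler_nat R) natr_sum sqr_enorm; apply: le_trans;
  apply: ler_sum => x _.
by rewrite mxE exprMn sqrr_sign mul1r natrX.
Qed.

Lemma net_round (u : 'rV[R]_n) : enorm u ^+ 2 <= N%:R ->
  exists2 z, z \in int_net & enorm (u - net_vec z) ^+ 2 <= n%:R.
Proof.
rewrite sqr_enorm => uN; pose m x := Num.truncn `|u 0 x|.
have m_itv x : (m x)%:R <= `|u 0 x| < (m x).+1%:R by exact: truncn_itv.
have m_sqr : (\sum_x m x ^ 2 <= N)%N.
  rewrite -(ler_nat R) natr_sum; apply: le_trans uN; apply: ler_sum => x _.
  rewrite natrX -[leRHS]real_normK ?num_real // lerXn2r ?nnegrE //.
  by case/andP: (m_itv x).
have m_lt x : (m x < N.+1)%N.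
  rewrite ltnS; apply: leq_trans m_sqr; rewrite (bigD1 x) //=.
  by apply: leq_trans (leq_addr _ _); case: (m x) => // i; rewrite leq_pmulr.
pose z : net_type := [ffun x => (Ordinal (m_lt x), u 0 x < 0)].
exists z; first by rewrite inE; under eq_bigr do rewrite ffunE.
rewrite sqr_enorm -[n in leRHS]card_ord -sumr_const; apply: ler_sum => x _.
rewrite !mxE ffunE /=; move: (m_itv x); rewrite -natr1; move: (m x)%:R => t.
case: (ltrP (u 0 x) 0) => [u_lt0|u_ge0] /andP[].
  by rewrite (ltr0_norm u_lt0) expr1; nra.
by rewrite (ger0_norm u_ge0) expr0; nra.
Qed.

Lemma sum_half_pow_le m : \sum_(i < m) (2^-1 : R) ^+ i <= 2.
Proof.
have := subrX1 (2^-1 : R) m; have : 0 <= (2^-1 : R) ^+ m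
  by rewrite exprn_ge0 ?invr_ge0.
by lra.
Qed.

(* Markov's inequality for the weight [2^-|z|^2]. *)
Lemma card_int_net : (#|int_net|%:R : R) <= 2 ^+ (2 * n + N).
Proof.
pose wt (p : 'I_N.+1 * bool) : R := 2^-1 ^+ (p.1 ^ 2).
have wt_ge0 p : 0 <= wt p by rewrite exprn_ge0 ?invr_ge0.
have half_pow_le i j : (i <= j)%N -> (2^-1 : R) ^+ j <= 2^-1 ^+ i.
  by move=> ij; rewrite ler_wiXn2l ?invr_ge0 ?invf_le1 ?ler1n.
have wt_sum : \sum_p wt p <= 2 ^+ 2.
  rewrite -(pair_bigA _ (fun i b => wt (i, b))) /=.
  under eq_bigr => i _ do rewrite big_bool /wt /= -mulr2n.
  rewrite sumrMnl -[leLHS]mulr_natl expr2 ler_pM2l //;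
    apply: le_trans (sum_half_pow_le N.+1).
  apply: ler_sum => i _; apply: half_pow_le.
  by case: (nat_of_ord i) => // j; rewrite leq_pmulr.
have markov : #|int_net|%:R * 2^-1 ^+ N <= \sum_(z : net_type) \prod_i wt (z i).
  rewrite [leRHS](bigID [in int_net]) /= -sumr_const mulr_suml -[leLHS]addr0
    lerD //.
    by apply: ler_sum => z; rewrite inE mul1r prodrXr; exact: half_pow_le.
  by apply: sumr_ge0 => z _; apply: prodr_ge0.
move: markov; rewrite -(bigA_distr_bigA (fun=> wt)) prodr_const card_ord.
rewrite exprVn ler_pdivrMr ?exprn_gt0 // => /le_trans; apply.
rewrite exprD ler_pM2r ?exprn_gt0 // exprM.
by rewrite lerXn2r ?nnegrE ?sumr_ge0 ?exprn_ge0.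
Qed.

End IntegerNet.

Section NetBound.
Import classical_sets.
Variables (R : realType) (n : nat) (M : 'M[R]_n) (b : R).
Local Notation ball_le u := (enorm u ^+ 2 <= (16 * n)%:R).
Local Notation vec := (@net_vec R n (16 * n)).
Hypothesis net_le : {in int_net n (16 * n) &, forall z w,
  bilin M (vec z) (vec w) <= b}.

(* Rounding both arguments to the net costs half of the supremum [s] over the
   ball, hence [s <= b + s / 2]. *)
Lemma bilin_ball_le (u v : 'rV[R]_n) : ball_le u -> ball_le v ->
  bilin M u v <= 2 * b.
Proof.
pose B := [set u : 'rV[R]_n | ball_le u]%classic.
pose S := [set bilin M u v | u in B & v in B]%classic.
have ubS : has_ubound S.
  exists (\sum_x \sum_y `|M x y| * (16 * n)%:R) => _ [u' uB [v' vB <-]].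
  rewrite bilinE; apply: ler_sum => x _; apply: ler_sum => y _.
  apply: le_trans (ler_norm _) _; rewrite normrM ler_wpM2l //.
  have := le_trans (sqr_entry_le u' x) uB.
  have := le_trans (sqr_entry_le v' y) vB.
  have := sqr_ge0 (u' 0 x - v' 0 y); have := sqr_ge0 (u' 0 x + v' 0 y).
  by rewrite ler_norml; move: (u' 0 x) (v' 0 y) => p q; nra.
have le_sup u' v' : ball_le u' -> ball_le v' -> bilin M u' v' <= sup S.
  by move=> uB vB; apply: (ub_le_sup ubS); exists u' => //; exists v'.
have dilate (w : 'rV[R]_n) : enorm w ^+ 2 <= n%:R -> ball_le (4 *: w).
  by move=> wn; rewrite enormZ exprMn ger0_norm // -natrX natrM ler_wpM2l.
suff half_sup : sup S <= b + sup S / 2.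
  by move=> uB vB; apply: le_trans (le_sup _ _ uB vB) _; lra.
have ball0 : ball_le (0 : 'rV[R]_n) by rewrite enorm0 expr0n ler0n.
apply: ge_sup => [|_ [u' uB [v' vB <-]]];
  first by exists (bilin M 0 0), 0 => //; exists 0.
have [z zN uz] := net_round uB; have [w wN vw] := net_round vB.
have near_u := le_sup _ _ (dilate _ uz) (sqr_enorm_net_vec R wN).
have near_v := le_sup _ _ uB (dilate _ vw).
rewrite bilinZl in near_u; rewrite bilinZr in near_v.
have -> : bilin M u' v' = bilin M (vec z) (vec w) +
    bilin M (u' - vec z) (vec w) + bilin M u' (v' - vec w).
  by rewrite -bilinDl subrKC -bilinDr subrKC.
by have := net_le zN wN; lra.
Qed.

Lemma opnorm_le_net : (0 < n)%N -> opnorm_le M (b / (8 * n%:R)).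
Proof.
move=> n0 u v; have nR : 0 < n%:R :> R by rewrite ltr0n.
have [u0|u_neq0] := eqVneq (enorm u) 0.
  by rewrite (enorm_eq0 u0) bilin0l enorm0 mul0r mulr0 normr0.
have [v0|v_neq0] := eqVneq (enorm v) 0.
  by rewrite (enorm_eq0 v0) bilin0r enorm0 !mulr0 normr0.
pose r : R := 4 * Num.sqrt n%:R.
pose unit_r (w : 'rV[R]_n) := (r / enorm w) *: w.
have r0 : 0 < r by rewrite mulr_gt0 ?sqrtr_gt0.
have r2 : r ^+ 2 = (16 * n)%:R by rewrite exprMn sqr_sqrtr // -natrX natrM.
have ball_r (w : 'rV[R]_n) e : e ^+ 2 = 1 -> enorm w != 0 ->
  ball_le (e *: unit_r w).
  move=> e1 w0; rewrite !enormZ !exprMn !real_normK ?num_real // e1 mul1r.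
  by rewrite exprMn exprVn mulfVK ?r2 // expf_neq0.
have pos_uv : 0 < enorm u * enorm v.
  by rewrite mulr_gt0 // lt_def enorm_ge0 ?u_neq0 ?v_neq0.
have signed e : e ^+ 2 = 1 ->
  e * bilin M u v <= b / (8 * n%:R) * (enorm u * enorm v).
  move=> e1; have := bilin_ball_le (ball_r u e e1 u_neq0)
    (ball_r v 1 (expr1n _ _) v_neq0).
  rewrite scale1r !bilinZl bilinZr.
  have -> : e * (r / enorm u * (r / enorm v * bilin M u v)) =
      r ^+ 2 * (e * bilin M u v / (enorm u * enorm v)).
    by field; rewrite u_neq0 v_neq0.
  rewrite r2 -ler_pdivlMl ?ltr0n ?muln_gt0 // ler_pdivrMr //.
  by congr (_ <= _ * _); rewrite natrM; field; rewrite gt_eqF.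
rewrite ler_norml lerNl -mulN1r signed ?sqrrN ?expr1n //=.
by rewrite -[leLHS]mul1r signed ?expr1n.
Qed.

End NetBound.

Section UniformProbability.
Variables (R : numFieldType) (T : finType).
Implicit Types E : {set T}.

Definition Pr E : R := #|E|%:R / #|T|%:R.

Lemma Pr_le E E' : E \subset E' -> Pr E <= Pr E'.
Proof.
by move=> EE'; rewrite ler_wpM2r ?invr_ge0 // ler_nat subset_leq_card.
Qed.

Lemma Pr_setU_le E E' : Pr (E :|: E') <= Pr E + Pr E'.
Proof.
rewrite -mulrDl ler_wpM2r ?invr_ge0 // -natrD ler_nat.
exact: (leq_card_setU _ _).1.
Qed.

Lemma Pr_bigcup_le (I : finType) (P : pred I) (E : I -> {set T}) (b : R) :
  (forall i, P i -> Pr (E i) <= b) -> Pr (\bigcup_(i | P i) E i) <= #|P|%:R * b.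
Proof.
move=> Eb; apply: (@le_trans _ _ (\sum_(i | P i) Pr (E i))); last first.
  by rewrite mulr_natl -sumr_const; exact: ler_sum.
apply: (big_rec2 (fun A p => Pr A <= p)) => [|i A p _ IH].
  by rewrite /Pr cards0 mul0r.
by apply: le_trans (Pr_setU_le _ _) _; rewrite lerD2l.
Qed.

Lemma Pr_not_le (I : finType) (P : pred I) (E : I -> {set T})
    (good : T -> Prop) b :
  (forall a, (forall i, P i -> a \notin E i) -> good a) ->
  (forall i, P i -> Pr (E i) <= b) ->
  Pr [set a | ~~ `[< good a >]] <= #|P|%:R * b.
Proof.
move=> goodE Eb; apply: le_trans (Pr_bigcup_le Eb); apply: Pr_le;
  apply/subsetP => a.
rewrite inE; apply: contraR => aE; apply/asboolP; apply: goodE => i Pi.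
by apply: contra aE => aEi; apply/bigcupP; exists i.
Qed.

Lemma Pr_preim f E : injective f -> Pr (f @^-1: E) = Pr E.
Proof. by move=> f_inj; rewrite /Pr card_preimset. Qed.

Lemma Pr_lt1_exists E : (0 < #|T|)%N -> Pr E < 1 -> exists a, a \notin E.
Proof.
move=> T0 E1; have /set0Pn[a] : ~: E != set0; last first.
  by rewrite inE => aE; exists a.
apply: contraTneq E1 => E0;
  rewrite -[E]setCK E0 setC0 /Pr cardsT divff ?ltxx //.
by rewrite pnatr_eq0 -lt0n.
Qed.

End UniformProbability.

Section Hoeffding.
Variable R : realType.

Lemma expR_symm_le (x : R) : expR x + expR (- x) <= 2 * expR (2 * x ^+ 2).
Proof.
case: (lerP (4 * x ^+ 2) 1) => x_small.
  have expR_le (y : R) : y < 1 -> expR y <= (1 - y)^-1.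
    move=> y1; rewrite -[y in leLHS]opprK expRN lef_pV2 ?posrE ?expR_gt0
      ?subr_gt0 //.
    exact: expR_ge1Dx.
  have x1 : x < 1 by nra.
  have x2 : - x < 1 by nra.
  apply: le_trans (lerD (expR_le _ x1) (expR_le _ x2)) _; rewrite opprK.
  apply: (@le_trans _ _ (2 * (1 + 2 * x ^+ 2)));
    last by rewrite ler_pM2l ?expR_ge1Dx.
  have -> : (1 - x)^-1 + (1 + x)^-1 = 2 / (1 - x ^+ 2).
    by field; rewrite !gt_eqF //; nra.
  by rewrite ler_pdivrMr; nra.
have le_exp (y : R) : y ^+ 2 = x ^+ 2 -> expR y <= expR (2 * x ^+ 2).
  by move=> yx; rewrite ler_expR -yx; nra.
by rewrite mulrC mulr_natr mulr2n lerD ?le_exp ?sqrrN.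
Qed.

Lemma mgf_signs_le (T : finType) (c : T -> R) :
  \sum_(a : {ffun T -> bool}) expR (\sum_t c t * (-1) ^+ a t) <=
  2 ^+ #|T| * expR (2 * \sum_t c t ^+ 2).
Proof.
under eq_bigr => a _ do rewrite expR_sum.
rewrite -(bigA_distr_bigA (fun t (b : bool) => expR (c t * (-1) ^+ b))).
rewrite mulr_sumr expR_sum -prodr_const -big_split /=; apply: ler_prod => t _.
rewrite big_bool /= expr1 expr0 mulr1 mulrN1 addrC expR_symm_le andbT.
by rewrite addr_ge0 ?expR_ge0.
Qed.

Lemma hoeffding_signs (T : finType) (c : T -> R) (V b : R) : 0 < V -> 0 <= b ->
  \sum_t c t ^+ 2 <= V ->
  Pr R [set a : {ffun T -> bool} | b < \sum_t c t * (-1) ^+ a t] <=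
  expR (- (b ^+ 2 / (8 * V))).
Proof.
move=> V0 b0 cV; set A := [set a | _]; pose l := b / (4 * V).
have l0 : 0 <= l by rewrite divr_ge0 // mulr_ge0 // ltW.
rewrite /Pr card_ffun card_bool natrX ler_pdivrMr ?exprn_gt0 //.
have chernoff : #|A|%:R * expR (l * b) <= 2 ^+ #|T| * expR (2 * (l ^+ 2 * V)).
  apply: (@le_trans _ _ (\sum_(a : {ffun T -> bool})
    expR (\sum_t (l * c t) * (-1) ^+ a t))).
    rewrite [leRHS](bigID [in A]) /= -sumr_const mulr_suml -[leLHS]addr0.
    rewrite lerD //.
      apply: ler_sum => a; rewrite inE mul1r ler_expR => ba.
      under eq_bigr => t _ do rewrite -mulrA.
      by rewrite -mulr_sumr ler_wpM2l // ltW.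
    by apply: sumr_ge0 => a _; rewrite expR_ge0.
  apply: le_trans (mgf_signs_le _) _;
    rewrite ler_wpM2l ?exprn_ge0 // ler_expR ler_wpM2l //.
  under eq_bigr => t _ do rewrite exprMn.
  by rewrite -mulr_sumr ler_wpM2l // sqr_ge0.
rewrite -(ler_pM2r (expR_gt0 (l * b))); apply: le_trans chernoff _.
rewrite [leRHS]mulrAC [leRHS]mulrC -expRD ler_wpM2l ?exprn_ge0 // ler_expR.
rewrite [leRHS](_ : _ = 2 * (l ^+ 2 * V)) ?lexx //.
by rewrite /l; field; rewrite gt_eqF.
Qed.

Lemma hoeffding_signs_inj (J T : finType) (P : pred J) (h : J -> T)
    (c : J -> R) (V b : R) :
  {in P &, injective h} -> 0 < V -> 0 <= b -> \sum_(j | P j) c j ^+ 2 <= V ->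
  Pr R [set a : {ffun T -> bool} | b < \sum_(j | P j) c j * (-1) ^+ a (h j)] <=
  expR (- (b ^+ 2 / (8 * V))).
Proof.
move=> h_inj V0 b0 cV; pose c' t := \sum_(j | P j && (h j == t)) c j.
have c'V : \sum_t c' t ^+ 2 <= V.
  apply: le_trans cV; rewrite [leRHS](partition_big h xpredT) //=.
  apply: ler_sum => t _; rewrite /c'.
  case: (pickP [pred j | P j && (h j == t)]) => [j /= /andP[Pj /eqP hj]|h0]; last first.
    by rewrite !big_pred0 // expr0n.
  have fibre i : P i && (h i == t) = (i == j).
    apply/andP/eqP => [[Pi /eqP hi]|->]; last by rewrite Pj hj.
    by apply: h_inj => //; rewrite hi hj.
  by rewrite !(eq_bigl _ _ fibre) !big_pred1_eq.
apply: le_trans (hoeffding_signs V0 b0 c'V).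
apply: Pr_le; apply/subsetP => a; rewrite !inE (partition_big h xpredT) //=.
move=> /lt_le_trans; apply; apply: ler_sum => t _; rewrite mulr_suml.
by apply: ler_sum => j /andP[_ /eqP <-].
Qed.

End Hoeffding.

Section RandomCoboundary.
Variables (R : realType) (n : nat).
Implicit Types (F G H W : {set 'I_n}) (w : 'I_n).
Local Notation omega := {ffun {set 'I_n} -> bool}.

Definition cobF2 (a : {set 'I_n} -> bool) H : bool :=
  \big[addb/false]_(G | facet G H) a G.

Definition cob_sign (a : {set 'I_n} -> bool) H : R := (-1) ^+ cobF2 a H.

Lemma cob_sign_le1 (a : {set 'I_n} -> bool) H : `|cob_sign a H| <= 1.
Proof. by rewrite normr_sign. Qed.

Lemma cobF2_setU1 (a : {set 'I_n} -> bool) w F : w \notin F ->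
  cobF2 a (w |: F) = a F (+) \big[addb/false]_(u in F) a (w |: F :\ u).
Proof.
move=> wF; rewrite /cobF2 big_facets big_setU1 //= setU1K //; congr (_ (+) _).
apply: eq_bigr => u uF; congr (a _); apply/setP => x; rewrite !inE.
by case: (eqVneq x w) => [->|//]; rewrite orTb andbT;
  apply: contraNneq wF => ->.
Qed.

Definition twist w (a : omega) : omega :=
  [ffun F : {set 'I_n} => if w \in F then a F else cobF2 a (w |: F)].

Lemma twistK w : involutive (twist w).
Proof.
move=> a; apply/ffunP => F; rewrite [LHS]ffunE; case: ifPn => [wF|wF].
  by rewrite ffunE wF.
rewrite cobF2_setU1 // ffunE (negPf wF) cobF2_setU1 //.
rewrite [X in _ (+) _ (+) X](eq_bigr (fun u => a (w |: F :\ u))).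
  by rewrite -addbA addbb addbF.
by move=> u _; rewrite ffunE setU11.
Qed.

(* For a fixed vertex [w] the values of the coboundary on the sets through [w]
   are, up to an involution of the cochains, independent fair coins. *)
Lemma hoeffding_cob_sign (J : finType) (P : pred J) (h : J -> {set 'I_n}) w
    (c : J -> R) (V b : R) :
  {in P, forall j, w \in h j} -> {in P &, injective h} ->
  0 < V -> 0 <= b -> \sum_(j | P j) c j ^+ 2 <= V ->
  Pr R [set a : omega | b < \sum_(j | P j) c j * cob_sign a (h j)] <=
  expR (- (b ^+ 2 / (8 * V))).
Proof.
move=> wh h_inj V0 b0 cV.
have h'_inj : {in P &, injective (fun j => h j :\ w)}.
  by move=> i j Pi Pj e; apply: h_inj => //;
    rewrite -(setD1K (wh i Pi)) e setD1K ?wh.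
apply: le_trans (hoeffding_signs_inj h'_inj V0 b0 cV).
rewrite -[leRHS](Pr_preim R _ (can_inj (twistK w))); apply: Pr_le;
  apply/subsetP => a.
rewrite !inE => /lt_le_trans; apply; apply: ler_sum => j Pj.
by rewrite ffunE setD11 setD1K ?wh.
Qed.

Definition off_pairs W : pred ('I_n * 'I_n) :=
  [pred p | [&& p.1 \notin W, p.2 \notin W & (p.1 < p.2)%N]].

Lemma bilin_upper_link_mx (t : {set 'I_n} -> R) W (u v : 'rV[R]_n) :
  bilin (upper_link_mx t W) u v =
  \sum_(p | off_pairs W p) (u 0 p.1 * v 0 p.2) * t (p.1 |: (p.2 |: W)).
Proof.
rewrite bilinE pair_bigA [RHS]big_mkcond; apply: eq_bigr => -[x y] _ /=.
by rewrite mxE /off_pairs /=; case: ifP => _; [exact: mulrC | exact: mul0r].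
Qed.

Lemma setU1_pair_inj W :
  {in off_pairs W &, injective (fun p => p.1 |: (p.2 |: W))}.
Proof.
move=> [x y] [x' y'] /and3P[/= xW yW xy] /and3P[/= xW' yW' xy'] e.
have mem u : u \notin W -> (u == x) || (u == y) = (u == x') || (u == y').
  by move=> uW; move/setP/(_ u): e; rewrite !inE (negPf uW) !orbF.
have := mem x xW; rewrite eqxx => /esym/orP[/eqP xx|/eqP xy_].
  subst x'; congr (_, _); have := mem y yW;
    rewrite eqxx orbT => /esym/orP[/eqP yx|/eqP //].
  by rewrite yx ltnn in xy.
have := mem y yW; rewrite eqxx orbT => /esym/orP[/eqP yx|/eqP yy].
  by rewrite xy_ yx in xy; have := ltn_trans xy xy'; rewrite ltnn.
by rewrite xy_ yy ltnn in xy.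
Qed.

Lemma Pr_upper_link_le W (u v : 'rV[R]_n) (V b : R) : W != set0 -> 0 < V ->
  0 <= b ->
  (enorm u * enorm v) ^+ 2 <= V ->
  Pr R [set a : omega | b < bilin (upper_link_mx (cob_sign a) W) u v] <=
  expR (- (b ^+ 2 / (8 * V))).
Proof.
case/set0Pn => w wW V0 b0 uvV.
have wh : {in predT, forall p : 'I_n * 'I_n, w \in p.1 |: (p.2 |: W)}.
  by move=> p _; rewrite !inE wW !orbT.
have cV : \sum_(p | off_pairs W p) (u 0 p.1 * v 0 p.2) ^+ 2 <= V.
  apply: le_trans uvV; rewrite exprMn !sqr_enorm mulr_suml.
  under [leRHS]eq_bigr => x _ do rewrite mulr_sumr.
  rewrite pair_bigA [leLHS]big_mkcond; apply: ler_sum => p _.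
  by case: ifP => _; rewrite ?exprMn // mulr_ge0 ?sqr_ge0.
have := hoeffding_cob_sign (in1W (in1T wh)) (@setU1_pair_inj W) V0 b0 cV.
by apply: le_trans; apply: Pr_le; apply/subsetP => a;
  rewrite !inE bilin_upper_link_mx.
Qed.

Lemma Pr_up_deg_le F (b : R) : F != set0 -> (0 < n)%N -> 0 <= b ->
  Pr R [set a : omega | up_deg (cob_sign a) F < - b] <=
    expR (- (b ^+ 2 / (8 * n%:R))).
Proof.
case/set0Pn => w wF n0 b0.
have nR : 0 < n%:R :> R by rewrite ltr0n.
have wh : {in [pred y | y \notin F], forall y, w \in y |: F}.
  by move=> y _; rewrite inE wF orbT.
have cV : \sum_(y | y \notin F) (-1) ^+ 2 <= n%:R :> R.
  under eq_bigr do rewrite sqrrN expr1n.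
  by rewrite sumr_const ler_nat (leq_trans (max_card _)) // card_ord.
apply: le_trans (hoeffding_cob_sign wh (@setU1_inj _ F) nR b0 cV).
apply: Pr_le; apply/subsetP => a; rewrite !inE /up_deg.
by rewrite -mulr_sumr mulN1r ltrNr.
Qed.

Lemma Pr_balanced_le (A : {set {set 'I_n}}) (g : {set 'I_n} -> bool) (b : R) :
  A != set0 -> 0 <= b ->
  Pr R [set a : omega | b < \sum_(F in A) (-1) ^+ (a F (+) g F)] <=
  expR (- (b ^+ 2 / (8 * #|A|%:R))).
Proof.
rewrite -card_gt0 -(ltr0n R) => A0 b0.
pose shift (a : omega) : omega := [ffun F => a F (+) g F].
have shiftK : involutive shift.
  by move=> a; apply/ffunP => F; rewrite !ffunE -addbA addbb addbF.
have cV : \sum_(F in A) (1 : R) ^+ 2 <= #|A|%:R.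
  by under eq_bigr do rewrite expr1n; rewrite sumr_const.
apply: le_trans (hoeffding_signs_inj (h := id) (in2W (fun _ _ => id)) A0 b0 cV).
rewrite -[leRHS](Pr_preim R _ (can_inj shiftK)); apply: Pr_le;
  apply/subsetP => a.
rewrite !inE => /lt_le_trans; apply; apply: ler_sum => F _.
by rewrite ffunE mul1r.
Qed.

End RandomCoboundary.

Section ExponentialBounds.
Variable R : realType.

Lemma pow2_expRN_le p q : (p + 2 <= q)%N -> 2 ^+ p * expR (- q%:R) <= 4^-1 :> R.
Proof.
move=> pq; rewrite -[- q%:R]mulr1 mulNr -mulrN expRM_natl.
have expRN1 : expR (- 1 : R) <= 2^-1.
  by rewrite expRN lef_pV2 ?posrE ?expR_gt0 // expR_ge1Dx.
apply: (@le_trans _ _ (2 ^+ p * 2^-1 ^+ q)).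
  by rewrite ler_wpM2l ?exprn_ge0 // lerXn2r ?nnegrE ?expR_ge0 ?invr_ge0.
rewrite -(subnKC pq) -addnA exprD mulrA -exprMn mulfV ?pnatr_eq0 //.
rewrite expr1n mul1r exprD.
rewrite (_ : 2^-1 ^+ 2 = 4^-1); last by rewrite exprVn -natrX.
by rewrite ler_piMr ?invr_ge0 // exprn_ile1 ?invr_ge0 // invf_le1 // ler1n.
Qed.

Lemma pow_expRN_le (c k n : nat) : (0 < c)%N ->
  (4 * (c * k.+1) ^ k.+1 <= n)%N ->
  (n ^ k)%:R * expR (- (n%:R / c%:R)) <= 4^-1 :> R.
Proof.
move=> c0 nbig; pose q : R := n%:R / (c * k.+1)%:R.
have nq : n%:R / c%:R = k.+1%:R * q.
  by rewrite /q natrM; field; rewrite nat1r !pnatr_eq0 -!lt0n c0.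
rewrite expRN -ler_pdivlMr ?invr_gt0 ?expR_gt0 // invrK ler_pdivlMl //.
apply: (@le_trans _ _ (q ^+ k.+1)).
  rewrite exprMn exprVn ler_pdivlMr ?exprn_gt0 ?ltr0n ?muln_gt0 ?c0 //.
  by rewrite -!natrX -!natrM ler_nat mulnAC [leqRHS]expnS leq_mul2r nbig orbT.
rewrite nq expRM_natl lerXn2r ?nnegrE ?expR_ge0 ?divr_ge0 //.
by apply: le_trans (expR_ge1Dx _); rewrite lerDr.
Qed.

End ExponentialBounds.

Lemma bin_le_exp n k : ('C(n, k) <= n ^ k)%N.
Proof.
elim: k => [|k IH]; first by rewrite bin0.
apply: (@leq_trans (k.+1 * 'C(n, k.+1))%N); first by rewrite leq_pmull.
by rewrite mul_bin_left expnS leq_mul // leq_subr.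
Qed.

(* Beyond it, the at most [n ^ m.+1] sets of size [m.+1] are outweighed by the
   deviation probability [expR (- (n / 128))]. *)
Definition threshold m : nat := (4 * (128 * m.+2) ^ m.+2)%N.

Lemma threshold_ge m : (4 * m.+2 <= threshold m)%N.
Proof.
rewrite leq_mul2l /= expnS; apply: (@leq_trans (128 * m.+2)%N);
  first exact: leq_pmull.
by rewrite leq_pmulr // expn_gt0.
Qed.

Section PseudorandomCochain.
Variables (R : realType) (n : nat).
Local Notation omega := {ffun {set 'I_n} -> bool}.
Local Notation K := (@sets_of_card n).
Implicit Types (m : nat) (a g : {set 'I_n} -> bool).

Definition small_links m a : Prop := forall W, W \in K m ->
  opnorm_le (upper_link_mx (cob_sign R a) W) (64 * Num.sqrt n%:R).

Definition large_degrees m a : Prop := forall F, F \in K m.+1 ->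
  - (n%:R / 4) <= up_deg (cob_sign R a) F.

Definition far_from_coboundaries m a : Prop := forall g,
  \sum_(F in K m.+1) (-1) ^+ (a F (+) cobF2 g F) <=
  8 * Num.sqrt ('C(n, m.+1) * 'C(n, m))%:R :> R.

Local Notation link_test :=
  ({set 'I_n} * (net_type n (16 * n) * net_type n (16 * n)))%type.

Definition link_failure (q : link_test) : {set omega} :=
  [set a : omega | 512 * n%:R * Num.sqrt n%:R <
    bilin (upper_link_mx (cob_sign R a) q.1)
      (net_vec R q.2.1) (net_vec R q.2.2)].

Definition link_tests m : {set link_test} :=
  setX (K m) (setX (int_net n (16 * n)) (int_net n (16 * n))).

Lemma card_link_tests_le m : (#|link_tests m|%:R : R) <= 2 ^+ (37 * n).
Proof.
have net_le : (#|int_net n (16 * n)|%:R : R) <= 2 ^+ (18 * n).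
  by apply: le_trans (card_int_net R n (16 * n)) _; rewrite -mulnDl.
have sets_le : (#|K m|%:R : R) <= 2 ^+ n.
  rewrite -natrX ler_nat; apply: leq_trans (max_card _) _.
  by rewrite -cardsT -powersetT card_powerset cardsT card_ord.
rewrite !cardsX !natrM (_ : (37 * n = n + (18 * n + 18 * n))%N); last by lia.
by rewrite (exprD 2 n) (exprD 2 (18 * n)%N) !ler_pM ?mulr_ge0.
Qed.

Lemma Pr_link_failure_le m q : (0 < n)%N -> (0 < m)%N -> q \in link_tests m ->
  Pr R (link_failure q) <= expR (- (128 * n)%:R).
Proof.
case: q => W [z w] n0 m0 /setXP[Wm /setXP[zN wN]].
have nR : 0 < n%:R :> R by rewrite ltr0n.
have -> : (128 * n)%:R =
    (512 * n%:R * Num.sqrt n%:R) ^+ 2 / (8 * (16 * n%:R) ^+ 2) :> R.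
  by rewrite !exprMn sqr_sqrtr // natrM; field; rewrite gt_eqF.
apply: Pr_upper_link_le;
  rewrite ?exprn_gt0 ?mulr_gt0 ?mulr_ge0 ?sqrtr_ge0 //.
  by move: Wm; rewrite inE -card_gt0 => /eqP ->.
by rewrite /= exprMn expr2 -natrM ler_pM ?sqr_ge0 ?sqr_enorm_net_vec.
Qed.

Lemma Pr_not_small_links m : (0 < n)%N -> (0 < m)%N ->
  Pr R [set a : omega | ~~ `[< small_links m a >]] <= 4^-1.
Proof.
move=> n0 m0; have nR : 0 < n%:R :> R by rewrite ltr0n.
have good (a : omega) :
    (forall q, q \in link_tests m -> a \notin link_failure q) ->
    small_links m a.
  move=> pass W Wm.
  rewrite (_ : 64 * _ = 512 * n%:R * Num.sqrt n%:R / (8 * n%:R)); last first.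
    by field; rewrite gt_eqF.
  apply: opnorm_le_net => // z w zN wN.
  have zw_test : (W, (z, w)) \in link_tests m by rewrite !in_setX Wm zN wN.
  by have := pass _ zw_test; rewrite inE -leNgt.
apply: le_trans (Pr_not_le good (fun q => Pr_link_failure_le n0 m0)) _.
apply: (@le_trans _ _ (2 ^+ (37 * n) * expR (- (128 * n)%:R))).
  by rewrite ler_wpM2r ?expR_ge0 ?card_link_tests_le.
by apply: pow2_expRN_le; lia.
Qed.

Lemma Pr_not_large_degrees m : (threshold m <= n)%N ->
  Pr R [set a : omega | ~~ `[< large_degrees m a >]] <= 4^-1.
Proof.
move=> nbig; have n0 : (0 < n)%N.
  by apply: leq_trans nbig; rewrite /threshold muln_gt0 expn_gt0.
pose bad F := [set a : omega | up_deg (cob_sign R a) F < - (n%:R / 4)].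
have good (a : omega) :
    (forall F, F \in K m.+1 -> a \notin bad F) -> large_degrees m a.
  by move=> notbad F /notbad; rewrite inE -leNgt.
have bad_le F : F \in K m.+1 -> Pr R (bad F) <= expR (- (n%:R / 128)).
  rewrite inE => /eqP cF.
  rewrite (_ : n%:R / 128 = (n%:R / 4) ^+ 2 / (8 * n%:R) :> R); last first.
    by field; rewrite pnatr_eq0 -lt0n.
  by apply: Pr_up_deg_le; rewrite ?divr_ge0 // -card_gt0 cF.
apply: le_trans (Pr_not_le good bad_le) _.
apply: le_trans (pow_expRN_le R (isT : 0 < 128)%N nbig).
by rewrite ler_wpM2r ?expR_ge0 // ler_nat card_sets_of_card bin_le_exp.
Qed.

Lemma Pr_not_far m : (m < n)%N ->
  Pr R [set a : omega | ~~ `[< far_from_coboundaries m a >]] <= 4^-1.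
Proof.
move=> mn; have N0 : (0 < 'C(n, m.+1))%N by rewrite bin_gt0.
have M0 : (0 < 'C(n, m))%N by rewrite bin_gt0 ltnW.
pose d (D : {set {set 'I_n}}) := cobF2 (fun G => G \in D).
pose bad D := [set a : omega | 8 * Num.sqrt ('C(n, m.+1) * 'C(n, m))%:R <
  \sum_(F in K m.+1) (-1) ^+ (a F (+) d D F) :> R].
have good (a : omega) : (forall D, D \in powerset (K m) -> a \notin bad D) ->
    far_from_coboundaries m a.
  move=> notbad g; have := notbad [set G in K m | g G];
    rewrite inE setIdE subsetIl.
  move=> /(_ isT); rewrite inE -leNgt; apply: le_trans; apply: ler_sum => F Fm.
  rewrite (_ : d _ F = cobF2 g F) //; apply: eq_bigr => G GF.
  by rewrite !inE; move: Fm; rewrite (facet_card_in _ GF) inE => ->.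
have bad_le D : D \in powerset (K m) ->
  Pr R (bad D) <= expR (- (8 * 'C(n, m))%:R).
  move=> _; rewrite (_ : (8 * _)%:R =
    (8 * Num.sqrt ('C(n, m.+1) * 'C(n, m))%:R) ^+ 2 /
      (8 * #|K m.+1|%:R) :> R).
    by apply: Pr_balanced_le; rewrite ?mulr_ge0 ?sqrtr_ge0 // -card_gt0
      card_sets_of_card.
  rewrite exprMn sqr_sqrtr // card_sets_of_card !natrM.
  by field; rewrite pnatr_eq0 -lt0n.
apply: le_trans (Pr_not_le good bad_le) _.
rewrite card_powerset card_sets_of_card natrX; apply: pow2_expRN_le.
by move: M0; move: 'C(n, m) => M; lia.
Qed.

Definition pseudorandom m a : Prop :=
  [/\ small_links m a, large_degrees m a & far_from_coboundaries m a].

Lemma pseudorandom_exists m : (0 < m)%N -> (threshold m <= n)%N ->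
  exists a, pseudorandom m a.
Proof.
move=> m0 nbig; have mn : (m < n)%N by have := threshold_ge m; lia.
pose bad (p : omega -> Prop) := [set a : omega | ~~ `[< p a >]].
pose bad_links := bad (small_links m); pose bad_degrees := bad (large_degrees m).
pose bad_far := bad (far_from_coboundaries m).
have omega_gt0 : (0 < #|omega|)%N by apply/card_gt0P; exists [ffun=> false].
have bad_lt1 : Pr R (bad_links :|: bad_degrees :|: bad_far) < 1.
  have union_le := Pr_setU_le R bad_links bad_degrees.
  apply: le_lt_trans (Pr_setU_le R _ bad_far) _.
  have links_le : Pr R bad_links <= 4^-1.
    by apply: Pr_not_small_links => //; exact: leq_ltn_trans mn.
  have degrees_le : Pr R bad_degrees <= 4^-1 by exact: Pr_not_large_degrees.
  have far_le : Pr R bad_far <= 4^-1 by exact: Pr_not_far.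
  by lra.
have [a] := Pr_lt1_exists omega_gt0 bad_lt1.
rewrite !inE !negb_or !negbK -andbA => /and3P[/asboolP ? /asboolP ? /asboolP ?].
by exists a.
Qed.

End PseudorandomCochain.

Section CompleteSkeleton.
Variables (n m : nat) (Y : {set {set 'I_n}}).
Hypothesis skelY : complete_skel Y m.+1.
Implicit Types (F G H W : {set 'I_n}) (f : {set 'I_n} -> R).
Local Notation K := (@sets_of_card n).

Definition face_ind H : R := (H \in Y)%:R.
Local Notation t := face_ind.

Lemma faces_skel s : (s <= m.+1)%N -> faces Y s = K s.
Proof.
move=> sm; apply/setP => F; rewrite !inE andbC.
by case: eqP => // cF; rewrite skelY // cF.
Qed.

Lemma incRE F G : incR F G = inc R F G.
Proof. by rewrite /incR /inc RpowE. Qed.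

Lemma incZE F G : incZ F G = inc Z F G.
Proof.
rewrite /incZ /inc; case: ifP => // _; elim: (incpos F G) => [|i IH] //.
by rewrite Nat2Z.inj_succ Z.pow_succ_r ?IH ?exprS //; apply: Nat2Z.is_nonneg.
Qed.

Lemma AupE F G : F \in K m.+1 -> Aup Y m.+1 F G = up_coef t F G.
Proof.
rewrite inE /Aup /up_coef /t !incRE => /eqP cF;
  case: (boolP (facet (F :&: G) F)) => FG.
  have /eqP -> : #|F :&: G| == m by rewrite -eqSS -cF (facet_card FG).
  by rewrite eqxx /=; case: (_ \in Y); rewrite ?mulr1 ?mulr0.
by rewrite inc_eq0 // RmultE !mul0r if_same.
Qed.

Lemma degE F : F \in K m.+1 -> INR (deg Y m.+1 F) = up_deg t F.
Proof.
move=> Fm; rewrite INRE /deg /up_deg -(big_cofacets _ F t) -natr_sum -sum1_card;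
  congr (_%:R).
rewrite [LHS]big_mkcond [RHS]big_mkcond; apply: eq_bigr => H _; rewrite !inE.
have := Fm; rewrite inE => /eqP cF.
case: (boolP (facet F H)) => [FH|nFH].
  by rewrite (facet_card FH) cF eqxx andbT (facet_sub FH) andbT;
    case: (_ \in Y).
case: (boolP (F \subset H)) => [sFH|]; rewrite ?andbF // andbT.
by rewrite facet_subE // cF in nFH; rewrite (negPf nFH) andbF.
Qed.

Lemma cobRE f F : F \in K m.+1 -> cobR Y m f F = cob f F.
Proof.
move=> Fm; rewrite /cobR /rsum faces_skel // (cobE_card _ Fm).
by apply: eq_bigr => W _; rewrite incRE.
Qed.

Lemma cob2E s (g : {set 'I_n} -> bool) H : (s <= m.+1)%N -> #|H| = s.+1 ->
  cob2 Y s g H = cobF2 g H.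
Proof.
move=> sm cH; apply: eq_bigl => G; rewrite faces_skel // inE.
by case: (boolP (facet G H)) => [/facet_card|]; rewrite ?andbF // cH => -[->];
  rewrite eqxx.
Qed.

Lemma bdZ_sum s (c : {set 'I_n} -> Z) W :
  bdZ Y s c W = \sum_(F in faces Y s) inc Z F W * c F.
Proof. by apply: eq_bigr => F _; rewrite incZE. Qed.

Lemma bdZE s (c : {set 'I_n} -> Z) W : (s <= m)%N -> W \in K s ->
  bdZ Y s.+1 c W = bd c W.
Proof. by move=> sm Ws; rewrite bdZ_sum faces_skel // (bdE_card _ Ws). Qed.

Lemma orthogonal_weighted_cycle f :
  (forall g, inner Y m.+1 f (cobR Y m g) = 0) -> weighted_cycle m t f.
Proof.
move=> orth W Wm; have := orth (fun W' => (W' == W)%:R);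
  rewrite /inner /rsum faces_skel //.
under eq_bigr => F Fm do rewrite degE // cobRE //.
rewrite cob_bd_adjoint (bigD1 W) //= eqxx mulr1 big1 ?addr0 //.
by move=> W' /andP[_ /negPf ->]; rewrite mulr0.
Qed.

Lemma up_form_eigen f (lam : R) :
  (forall F, F \in K m.+1 -> 0 < up_deg t F) ->
  (forall F, F \in K m.+1 -> Lap_up Y m.+1 f F = lam * f F) ->
  up_form m.+1 t f f = (1 - lam) * \sum_(F in K m.+1) up_deg t F * f F ^+ 2.
Proof.
move=> deg_gt0 eig; rewrite mulr_sumr; apply: eq_bigr => F Fm.
have deg_neq0 : up_deg t F != 0 by rewrite gt_eqF ?deg_gt0.
have eigF : f F - (up_deg t F)^-1 * (\sum_(G in K m.+1) up_coef t F G * f G) =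
  lam * f F.
  rewrite -(eig F Fm) /Lap_up degE // /rsum faces_skel //; congr (_ - _ * _).
  by apply: eq_bigr => G _; rewrite AupE.
transitivity (f F * \sum_(G in K m.+1) up_coef t F G * f G).
  by rewrite mulr_sumr; apply: eq_bigr => G _; ring.
have -> : \sum_(G in K m.+1) up_coef t F G * f G =
  up_deg t F * (f F - lam * f F).
  by rewrite -eigF; field.
by ring.
Qed.

Lemma nontrivial_eig_dist (B d lam : R) : 0 < d ->
  (forall F, F \in K m.+1 -> d <= up_deg t F) ->
  (forall f, weighted_cycle m t f -> `|up_form m.+1 t f f| <=
    B * cochain_norm m.+1 f ^+ 2) ->
  nontrivial_eig Y m.+1 lam -> `|1 - lam| <= B / d.
Proof.
move=> d0 deg_ge form_le [f [[F0 [F0Y /eqP f0]] [orth eig]]].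
rewrite faces_skel // in F0Y eig.
have deg_gt0 F : F \in K m.+1 -> 0 < up_deg t F.
  by move/deg_ge; exact: lt_le_trans.
have N0 : 0 < cochain_norm m.+1 f ^+ 2.
  rewrite sqr_cochain_norm (bigD1 F0) //= ltr_pwDl ?exprn_even_gt0 //.
  exact: sum_sqr_ge0.
have degN : d * cochain_norm m.+1 f ^+ 2 <=
  \sum_(F in K m.+1) up_deg t F * f F ^+ 2.
  rewrite sqr_cochain_norm mulr_sumr; apply: ler_sum => F Fm.
  by rewrite ler_wpM2r ?sqr_ge0 ?deg_ge.
rewrite ler_pdivlMr // -(ler_pM2r N0) -mulrA.
apply: le_trans (form_le f (orthogonal_weighted_cycle orth)).
rewrite (up_form_eigen deg_gt0 eig) normrM ler_wpM2l //.
exact: le_trans (ler_norm _).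
Qed.

Lemma card_top_faces :
  m.+2%:R * #|faces Y m.+2|%:R = \sum_(F in K m.+1) up_deg t F :> R.
Proof.
under eq_bigr => F _ do rewrite /up_deg -(big_cofacets _ F t).
rewrite sum_facets_exchange -sum1_card natr_sum mulr_sumr.
rewrite [LHS]big_mkcond [RHS]big_mkcond; apply: eq_bigr => H _.
rewrite !inE andbC; case: eqP => //= cH.
rewrite (big_facets _ H (fun=> t H)) /= sumr_const cH /face_ind.
by case: (_ \in Y); rewrite /= ?mulr1 ?mul0rn.
Qed.

Lemma norm2_star_le (v0 : 'I_n) (g : {set 'I_n} -> bool) (d : R) :
  (m.+1 <= n)%N -> 0 < d -> (forall F, F \in K m.+1 -> d <= up_deg t F) ->
  (forall H, H \in faces Y m.+2 -> g H -> v0 \in H) ->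
  norm2 Y m.+2 g <= m.+2%:R / d.
Proof.
move=> mn d0 deg_ge star; rewrite /norm2 !INRE RdivE.
have star_card : (#|[set H in faces Y m.+2 | g H]| <= 'C(n, m.+1))%N.
  have inS H : H \in [set H in faces Y m.+2 | g H] -> v0 \in H /\ #|H| = m.+2.
    rewrite inE => /andP[HY gH]; split; first exact: star.
    by move: HY; rewrite inE => /andP[_ /eqP].
  rewrite -card_sets_of_card -(card_in_imset (f := fun H => H :\ v0)).
    apply: subset_leq_card; apply/subsetP => _ /imsetP[H /inS[vH cH] ->].
    by rewrite inE -eqSS -cH (cardsD1 v0 H) vH.
  by move=> H H' /inS[vH _] /inS[vH' _] e; rewrite -(setD1K vH) e setD1K.
have top : d * 'C(n, m.+1)%:R <= m.+2%:R * #|faces Y m.+2|%:R.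
  rewrite card_top_faces -card_sets_of_card mulr_natr -sumr_const.
  exact: ler_sum.
have C0 : 0 < 'C(n, m.+1)%:R :> R by rewrite ltr0n bin_gt0.
have T0 : 0 < #|faces Y m.+2|%:R :> R.
  by rewrite -(pmulr_rgt0 _ (ltr0Sn R m.+1)); apply: lt_le_trans top;
    rewrite mulr_gt0.
rewrite ler_pdivrMr // mulrAC ler_pdivlMr // mulrC.
by apply: le_trans top; rewrite ler_pM2l // ler_nat.
Qed.

Lemma class_norm2_ge (a : {set 'I_n} -> bool) (b : R) : (m.+1 <= n)%N ->
  0 <= b ->
  (forall g : {set 'I_n} -> bool,
    \sum_(F in K m.+1) (-1) ^+ (a F (+) cobF2 g F) <= b) ->
  2^-1 - b / (2 * 'C(n, m.+1)%:R) <= class_norm2 Y m.+1 a.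
Proof.
move=> mn b0 balanced; rewrite /class_norm2 !INRE RdivE faces_skel //
  card_sets_of_card.
have C0 : 0 < 'C(n, m.+1)%:R :> R by rewrite ltr0n bin_gt0.
rewrite ler_pdivlMr // [leLHS](_ : _ = 2^-1 * ('C(n, m.+1)%:R - b)); last first.
  by field; rewrite gt_eqF.
apply: (big_ind (fun p : nat => 2^-1 * ('C(n, m.+1)%:R - b) <= p%:R)).
- by move: b0 C0; lra.
- by move=> p q ? ?; rewrite /minn; case: ifP.
move=> g _; have := balanced g; set A := [set F in K m.+1 | _].
have -> : \sum_(F in K m.+1) (-1) ^+ (a F (+) cobF2 g F) =
  'C(n, m.+1)%:R - 2 * #|A|%:R :> R.
  rewrite (eq_bigr (fun F => 1 - 2 * (a F (+) cobF2 g F)%:R)) => [|F _]; last first.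
    by case: (_ (+) _) => /=; rewrite ?expr1 ?expr0; ring.
  rewrite sumrB -mulr_sumr sumr_const card_sets_of_card; congr (_ - 2 * _).
  rewrite -natr_sum -sum1_card; congr (_%:R);
    rewrite [LHS]big_mkcond [RHS]big_mkcond.
  apply: eq_bigr => F _; rewrite !inE; case: eqP => //= cF.
  by rewrite cob2E //; case: (_ (+) _).
by lra.
Qed.

End CompleteSkeleton.

Section ConeComplex.
Variables (n m : nat) (v0 : 'I_n) (B : pred {set 'I_n}).
Implicit Types (F G H W : {set 'I_n}).

Definition cone_complex : {set {set 'I_n}} :=
  [set H : {set 'I_n} | (#|H| <= m.+1)%N ||
     ((#|H| == m.+2) && ((v0 \in H) || B H))].
Local Notation Y := cone_complex.

Lemma cone_complex_is_complex : is_complex Y.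
Proof.
move=> F G; rewrite !inE => FY sGF; have cGF := subset_leq_card sGF.
case/orP: FY => [cF|/andP[/eqP cF BF]]; first by rewrite (leq_trans cGF cF).
rewrite cF leq_eqVlt ltnS in cGF; case/orP: cGF => [/eqP cG|-> //].
have /eqP-> : G == F by rewrite eqEcard sGF cF cG leqnn.
by rewrite cF eqxx BF orbT.
Qed.

Lemma cone_complex_skel : complete_skel Y m.+1.
Proof. by move=> F cF; rewrite inE cF. Qed.

Lemma mem_cone_complex H : v0 \in H -> (#|H| <= m.+2)%N -> H \in Y.
Proof. by move=> vH; rewrite inE vH andbT orbC -ltnS -leq_eqVlt. Qed.

Lemma cone_complex_pure : (m.+1 < n)%N -> pure_dim Y m.+1.
Proof.
move=> mn F FY max; apply/eqP; move: FY; rewrite inE => /orP[cF|/andP[]//].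
have grow x : x \notin F -> v0 \in x |: F -> #|F| == m.+2.
  move=> xF vF; have := max (x |: F) (mem_cone_complex vF _) (subsetUr _ _).
  rewrite cardsU1 xF ltnS cF => /(_ isT) e; have := setU11 x F.
  by rewrite e (negPf xF).
case: (boolP (v0 \in F)) => vF; last by apply: (grow v0) => //; rewrite setU11.
have : (0 < #|[pred x | x \notin F]|)%N.
  by rewrite card_notin subn_gt0 (leq_ltn_trans cF).
by case/card_gt0P => x xF; apply: (grow x) => //; rewrite in_setU1 vF orbT.
Qed.

Lemma cone_complex_homology i : (i <= m)%N -> red_hom_vanishes Y i.
Proof.
move=> im c cycle_c; have skelY := cone_complex_skel;
  exists (cone_op v0 c) => F.
rewrite (faces_skel skelY) // => Fi.
transitivity (bd (cone_op v0 c) F); last first.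
  rewrite (bdE_card _ Fi) bdZ_sum [LHS]big_mkcond [RHS]big_mkcond;
    apply: eq_bigr => H _.
  rewrite [H \in faces _ _]inE [H \in sets_of_card _ _]inE andbC.
  case: eqP => //= cH; case: ifPn => // HY; rewrite cone_op_notin ?mulr0 //.
  by apply: contra HY => vH; rewrite mem_cone_complex ?cH.
rewrite bd_cone_op; case: (boolP (v0 \in F)) => vF;
  last by rewrite [cone_op _ (bd _) _]cone_op_notin ?subr0.
have Gi : F :\ v0 \in sets_of_card n i.
  by move: Fi; rewrite !inE (cardsD1 v0 F) vF.
by rewrite /cone_op -(bdZE skelY _ im Gi) cycle_c ?mulr0 ?subr0 //
  (faces_skel skelY) // ltnW.
Qed.

Lemma face_ind_star H : v0 \in H -> #|H| = m.+2 -> face_ind Y H = 1.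
Proof. by move=> vH cH; rewrite /face_ind mem_cone_complex ?cH. Qed.

Lemma cone_complex_cycle (f : {set 'I_n} -> R) W : (m.+1 < n)%N ->
  weighted_cycle m (face_ind Y) f -> W \in sets_of_card n m -> v0 \in W ->
    bd f W = 0.
Proof.
move=> mn cycle_f Wm vW; have := cycle_f W Wm.
rewrite !(bdE_card _ Wm).
under eq_bigr => F Fm.
  rewrite (_ : _ * _ = (n - m.+1)%:R * (inc R F W * f F)).
    over.
  case: (boolP (facet W F)) => WF; last by rewrite inc_eq0 // !mul0r mulr0.
  have vF : v0 \in F by apply: (subsetP (facet_sub WF)).
  move: Fm; rewrite inE => /eqP cF;
    rewrite /up_deg (eq_bigr (fun=> 1)) => [|x xF].
    by rewrite sumr_const card_notin cF; ring.
  by rewrite face_ind_star ?cardsU1 ?xF ?cF // in_setU1 vF orbT.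
rewrite -mulr_sumr => /eqP; rewrite mulf_eq0 pnatr_eq0 subn_eq0 leqNgt mn /=.
by move/eqP.
Qed.

End ConeComplex.

Section CocycleCone.
Variables (n m : nat) (v0 : 'I_n) (a : {set 'I_n} -> bool).
Implicit Types (F H W : {set 'I_n}).
Local Notation K := (@sets_of_card n).

Definition cocycle_cone : {set {set 'I_n}} :=
  cone_complex m v0 (fun H => ~~ cobF2 a H).
Local Notation Y := cocycle_cone.

Let skelY : complete_skel Y m.+1 := @cone_complex_skel _ _ _ _.

Lemma cocycle_cone_face_ind :
  {in K m.+2, face_ind Y =1 cone_fun v0 (cob_sign R a)}.
Proof.
move=> H; rewrite inE => /eqP cH.
rewrite /face_ind /cone_fun inE cH ltnn eqxx /= /cob_sign.
by case: (v0 \in H) => //=; case: (cobF2 a H) => /=; rewrite ?expr1 ?expr0; lra.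
Qed.

Lemma cocycle_cone_deg_ge F : (4 * m.+1 <= n)%N -> large_degrees R m a ->
  F \in K m.+1 ->
  n%:R / 4 <= up_deg (face_ind Y) F.
Proof.
move=> mn large Fm.
have sum_le : \sum_(x | x \notin F) 2^-1 * (1 + cob_sign R a (x |: F)) <=
    up_deg (face_ind Y) F.
  apply: ler_sum => x xF; rewrite cocycle_cone_face_ind; last first.
    by move: Fm; rewrite !inE cardsU1 xF => /eqP ->.
  rewrite /cone_fun; case: ifP => // _.
  by have := cob_sign_le1 R a (x |: F); rewrite ler_norml => /andP[_]; lra.
apply: le_trans sum_le; rewrite -mulr_sumr big_split /= sumr_const card_notin.
move: (Fm); rewrite inE => /eqP ->; rewrite natrB; last by lia.
have := large F Fm; rewrite /up_deg; have : (4 * m.+1)%:R <= n%:R :> R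
  by rewrite ler_nat.
by rewrite natrM; lra.
Qed.

Lemma cocycle_cone_up_form_le (f : {set 'I_n} -> R) : (m.+1 < n)%N ->
  small_links R m a ->
  weighted_cycle m (face_ind Y) f ->
  `|up_form m.+1 (face_ind Y) f f| <=
  2 * (67 * Num.sqrt n%:R) * m.+1%:R * cochain_norm m.+1 f ^+ 2.
Proof.
move=> mn small cycle_f.
apply: (@up_form_le _ _ _ _ (cone_weight R v0) 2^-1) => //.
- by rewrite mulr_ge0 ?sqrtr_ge0.
- by rewrite invr_ge0.
- move=> W Wm; rewrite (eq_link_mx Wm cocycle_cone_face_ind).
  rewrite (_ : 67 = 64 + 3); last by rewrite -natrD.
  by apply: link_mx_cone_le => // [H|]; [exact: cob_sign_le1 | exact: small].
- move=> W Wm; rewrite /cone_weight; case: ifP => // vW.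
  by rewrite (cone_complex_cycle mn cycle_f) // !mulr0.
Qed.

Lemma cocycle_cone_eig_dist (lam : R) : (4 * m.+1 <= n)%N ->
  small_links R m a -> large_degrees R m a -> nontrivial_eig Y m.+1 lam ->
  `|1 - lam| <= (536 * m.+1)%:R / Num.sqrt n%:R.
Proof.
move=> mn small large eig; have nR : 0 < n%:R :> R by rewrite ltr0n; lia.
have mn' : (m.+1 < n)%N by lia.
have -> : (536 * m.+1)%:R / Num.sqrt n%:R =
    2 * (67 * Num.sqrt n%:R) * m.+1%:R / (n%:R / 4) :> R.
  have sqrt_n : n%:R = Num.sqrt n%:R ^+ 2 :> R by rewrite sqr_sqrtr // ltW.
  by rewrite [X in _ / (X / 4)]sqrt_n natrM; field; rewrite gt_eqF ?sqrtr_gt0.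
apply: (nontrivial_eig_dist skelY) eig; first by rewrite divr_gt0.
  by move=> F; exact: cocycle_cone_deg_ge.
by move=> f; exact: cocycle_cone_up_form_le.
Qed.

Lemma cocycle_cone_norm2_le : (4 * m.+1 <= n)%N -> large_degrees R m a ->
  norm2 Y m.+2 (cob2 Y m.+1 a) <= (4 * m.+2)%:R / n%:R.
Proof.
move=> mn large; have nR : 0 < n%:R :> R by rewrite ltr0n; lia.
have -> : (4 * m.+2)%:R / n%:R = m.+2%:R / (n%:R / 4) :> R.
  by rewrite natrM; field; rewrite gt_eqF.
apply: (norm2_star_le (v0 := v0)); [lia | by rewrite divr_gt0 | |].
  by move=> F; exact: cocycle_cone_deg_ge.
move=> H; rewrite inE => /andP[HY /eqP cH]; rewrite (cob2E skelY) // => aH.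
by move: HY; rewrite inE cH ltnn eqxx aH orbF.
Qed.

Lemma cocycle_cone_class_norm2_ge : (m.+1 <= n)%N ->
  far_from_coboundaries R m a ->
  2^-1 - 4 * Num.sqrt (m.+1%:R / (n - m)%:R) <= class_norm2 Y m.+1 a.
Proof.
move=> mn far; apply: le_trans (class_norm2_ge skelY mn _ far); last first.
  by rewrite mulr_ge0 ?sqrtr_ge0.
have C0 : 0 < 'C(n, m.+1)%:R :> R by rewrite ltr0n bin_gt0.
have nm0 : 0 < (n - m)%:R :> R by rewrite ltr0n subn_gt0.
rewrite lerD2l lerN2 [leLHS](_ : _ = 4 * Num.sqrt (m.+1%:R / (n - m)%:R));
  first exact: lexx.
have -> : m.+1%:R / (n - m)%:R = 'C(n, m)%:R / 'C(n, m.+1)%:R :> R.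
  apply/eqP; rewrite eqr_div ?(gt_eqF C0) ?(gt_eqF nm0) // -!natrM eqr_nat.
  by rewrite mul_bin_left mulnC.
have -> : ('C(n, m.+1) * 'C(n, m))%:R =
    'C(n, m.+1)%:R ^+ 2 * ('C(n, m)%:R / 'C(n, m.+1)%:R) :> R.
  by rewrite natrM; field; rewrite gt_eqF.
rewrite sqrtrM ?sqr_ge0 // sqrtr_sqr gtr0_norm //.
by field; rewrite gt_eqF.
Qed.

End CocycleCone.

Lemma sqrt_ratio_small m (eps : R) : 0 < eps ->
  exists N, forall n, (N <= n)%N -> 4 * Num.sqrt (m.+1%:R / (n - m)%:R) <= eps.
Proof.
move=> eps0; pose p := Num.bound (16 * m.+1%:R / eps ^+ 2).
exists (p + m.+1)%N => n np; have nm0 : 0 < (n - m)%:R :> R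
  by rewrite ltr0n subn_gt0; lia.
rewrite -(@ler_pXn2r _ 2) ?nnegrE ?mulr_ge0 ?sqrtr_ge0 ?(ltW eps0) //.
rewrite exprMn sqr_sqrtr ?divr_ge0 // -natrX mulrA ler_pdivrMr //.
rewrite [leRHS]mulrC -ler_pdivrMr ?exprn_gt0 //;
  apply/ltW/(lt_le_trans (archi_boundP _)).
  by rewrite divr_ge0 ?sqr_ge0 // mulr_ge0 ?ler0n.
by rewrite -/p ler_nat; lia.
Qed.

Lemma pseudorandom_sequence m : (0 < m)%N ->
  exists a : forall n, {set 'I_n} -> bool,
    forall n, (threshold m <= n)%N -> pseudorandom R m (a n).
Proof.
move=> m0; have pr_n n : exists a : {set 'I_n} -> bool,
    (threshold m <= n)%N -> pseudorandom R m a.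
  case: (leqP (threshold m) n) => [nbig|_]; last by exists xpred0.
  by have [a pr_a] := pseudorandom_exists R m0 nbig; exists a.
by exists (fun n => sval (cid (pr_n n))) => n; exact: svalP (cid (pr_n n)).
Qed.

Definition cocycle_cone_family m (a : forall n, {set 'I_n} -> bool) n :
  {set {set 'I_n}} :=
  match n return {set {set 'I_n}} with
  | 0 => set0
  | n'.+1 => cocycle_cone m ord0 (a n'.+1)
  end.

Lemma ln_INR_ge1 n : (3 < n)%N -> 1 <= Rpower.ln (INR n).
Proof.
move=> n3; apply/RleP; rewrite -[X in Rle X _](ln_exp (IZR 1)).
apply/Rlt_le/ln_increasing; first exact: exp_pos.
apply: (Rle_lt_trans _ _ _ exp_le_3); rewrite (_ : IZR 3 = INR 3);
  last by rewrite INR_IZR_INZ.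
exact/lt_INR/ssrnat.ltP.
Qed.

Lemma cocycle_cone_family_eig m a n (lam : R) : (threshold m <= n)%N ->
  pseudorandom R m (a n) ->
  nontrivial_eig (cocycle_cone_family m a n) m.+1 lam ->
  1 - (536 * m.+1)%:R / Num.sqrt n%:R <= lam <=
    1 + (536 * m.+1)%:R / Num.sqrt n%:R.
Proof.
have := threshold_ge m; case: n => [|n] thr nbig [small large _] eig;
  first by lia.
by rewrite -ler_distlC; apply: cocycle_cone_eig_dist small large eig; lia.
Qed.

Lemma cocycle_cone_family_norm2 m a n : (threshold m <= n)%N ->
  pseudorandom R m (a n) ->
  norm2 (cocycle_cone_family m a n) m.+2
    (cob2 (cocycle_cone_family m a n) m.+1 (a n)) <=
  (536 * m.+1)%:R * Rpower.ln (INR n) / n%:R.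
Proof.
have := threshold_ge m; case: n => [|n] thr nbig [_ large _]; first by lia.
apply: le_trans (cocycle_cone_norm2_le _ _ large) _; first by lia.
rewrite ler_wpM2r ?invr_ge0 //; apply: (@le_trans _ _ (536 * m.+1)%:R).
  by rewrite ler_nat; lia.
by rewrite ler_peMr // ln_INR_ge1 //; lia.
Qed.

Lemma cocycle_cone_family_class_norm2 m a (eps : R) : 0 < eps ->
  (forall n, (threshold m <= n)%N -> pseudorandom R m (a n)) ->
  exists N, forall n, (N <= n)%N ->
    2^-1 - eps <= class_norm2 (cocycle_cone_family m a n) m.+1 (a n).
Proof.
move=> eps0 pr_a; have [N small] := sqrt_ratio_small m eps0.
exists (N + threshold m)%N => n nbig; have [|_ _ far] := pr_a n; first by lia.
have := threshold_ge m; case: n nbig far => [|n] nbig far thr; first by lia.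
apply: le_trans (cocycle_cone_class_norm2_ge ord0 _ far); last by lia.
by rewrite lerD2l lerN2; apply: small; lia.
Qed.

Delimit Scope R_scope with R.
Local Close Scope ring_scope.
Local Open Scope R_scope.
(* The [ln] of the statement is the one of Stdlib, shadowed by that of [exp]. *)
Import Rpower.

Theorem theorem1p4 :
  forall k : nat, (2 <= k)%N ->
  exists C : R, (0 < C)%R /\
  exists (N0 : nat) (Y : forall n : nat, {set {set 'I_n}})
         (a : forall n : nat, {set 'I_n} -> bool),
    (forall n : nat, (N0 <= n)%N ->
       is_complex (Y n) /\ pure_dim (Y n) k /\ complete_skel (Y n) k /\
       (forall lam : R, nontrivial_eig (Y n) k lam ->
          (1 - C / sqrt (INR n) <= lam <= 1 + C / sqrt (INR n))%R) /\
       (norm2 (Y n) k.+1 (cob2 (Y n) k (a n)) <= C * ln (INR n) / INR n)%R /\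
       (forall i : nat, (i <= k.-1)%N -> red_hom_vanishes (Y n) i)) /\
    (forall eps : R, (0 < eps)%R ->
       exists N : nat, forall n : nat, (N <= n)%N ->
         (1 / 2 - eps <= class_norm2 (Y n) k (a n))%R).
Proof.
case=> [//|m] m_gt0; have [a pr_a] := pseudorandom_sequence m_gt0.
exists (INR (536 * m.+1)); split; first by apply: lt_0_INR; apply/ssrnat.ltP.
exists (threshold m), (cocycle_cone_family m a), a; split; last first.
  move=> eps /RltP eps0; have [N class_ge] :=
    cocycle_cone_family_class_norm2 eps0 pr_a.
  by exists N => n /class_ge /RleP; rewrite /Rdiv Rmult_1_l.
have thr := threshold_ge m; case=> [|n] nbig; first by lia.
have pr_an := pr_a n.+1 nbig.
split; first exact: cone_complex_is_complex.
split; first by apply: cone_complex_pure; lia.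
split; first exact: cone_complex_skel.
split; [|split].
- move=> lam /(cocycle_cone_family_eig nbig pr_an) /andP[/RleP lo /RleP hi].
  by rewrite RsqrtE !INRE !RdivE.
- by have /RleP := cocycle_cone_family_norm2 nbig pr_an; rewrite -!INRE -RdivE.
- by move=> i; exact: cone_complex_homology.
Qed.
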